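(* Let $\mathcal{P} \subset \mathbb{R}^N$ be an integral convex polytope of dimension $d$. Then \[ 1 \leq \mu_{\mathrm{va}}(\mathcal{P}) \leq \mu_{\mathrm{midp}}(\mathcal{P}) \leq \mu_{\mathrm{idp}}(\mathcal{P}) \leq \mu_{\mathrm{hole}}(\mathcal{P}) \leq \mu_{\mathrm{Ehr}}(\mathcal{P}) \leq d \] and \[ 1 \leq \mu_{\mathrm{va}}(\mathcal{P}) \leq \mu_{\mathrm{Hilb}}(\mathcal{P}) \leq \mu_{\mathrm{hole}}(\mathcal{P}) \leq d-1. \]
   Context: An integral convex polytope is a convex polytope whose vertices lie in $\mathbb{Z}^N$; $k\mathcal{P}=\{k\alpha:\alpha\in\mathcal{P}\}$. A polytope $\mathcal{Q}$ has the integer decomposition property (IDP) if for every integer $k\ge 1$ and every $\alpha\in k\mathcal{Q}\cap\mathbb{Z}^N$ there are $\alpha_1,\dots,\alpha_k\in\mathcal{Q}\cap\mathbb{Z}^N$ with $\alpha=\alpha_1+\cdots+\alpha_k$; $\mathcal{Q}$ is very ample if this holds for all sufficiently large $k$. Let $\widetilde{\mathcal{P}}=\{(\alpha,1):\alpha\in\mathcal{P}\}\subset\mathbb{R}^{N+1}$ and $\mathcal{C}(\mathcal{P})$ the cone generated by the vertices of $\widetilde{\mathcal{P}}$; the degree of $(\alpha,n)\in\mathcal{C}(\mathcal{P})\cap\mathbb{Z}^{N+1}$ is $n$. $\mathcal{H}(\mathcal{C}(\mathcal{P}))$ denotes the unique minimal Hilbert basis of $\mathcal{C}(\mathcal{P})$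 (minimal finite set of integer vectors whose nonnegative integer combinations give $\mathcal{C}(\mathcal{P})\cap\mathbb{Z}^{N+1}$). A simplex $\mathcal{S}$ is empty if $\mathcal{S}\cap\mathbb{Z}^N$ is its vertex set; for an empty simplex with vertices $v_i$, $\mathrm{Box}(\mathcal{S})=\{\sum_i r_i(v_i,1)\in\mathbb{Z}^{N+1}: 0\le r_i<1\}$. Define $\mathrm{Box}(\mathcal{P})=\bigcup_{\mathcal{S}}\mathrm{Box}(\mathcal{S})\setminus \mathbb{Z}_{\ge0}(\widetilde{\mathcal{P}}\cap\mathbb{Z}^{N+1})$, the union over all empty $d$-dimensional simplices $\mathcal{S}\subset\mathcal{P}$ (here $\mathbb{Z}_{\ge 0}(X)$ denotes nonnegative integer combinations of elements of $X$). The $\delta$-vector $(\delta_0,\dots,\delta_d)$ of $\mathcal{P}$ is defined by $\sum_{n\ge0}|n\mathcal{P}\cap\mathbb{Z}^N|t^n=(\sum_{i=0}^d\delta_it^i)/(1-t)^{d+1}$. Invariants: $\mu_{\mathrm{va}}(\mathcal{P})$ = smallest $k>0$ with $k\mathcal{P}$ very ample; $\mu_{\mathrm{midp}}(\mathcal{P})$ = smallest $k>0$ with $k\mathcal{P}$ having IDP; $\mu_{\mathrm{idp}}(\mathcal{P})$ = smallest $k>0$ such that $n\mathcal{P}$ has IDP for all $n\ge k$; $\mu_{\mathrm{Hilb}}(\mathcal{P})$ = maximal degree of elements of $\mathcal{H}(\mathcal{C}(\mathcal{P}))$; $\mu_{\mathrm{hole}}(\mathcal{P})$ = maximal degree of elements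 of $\mathrm{Box}(\mathcal{P})$, with $\mu_{\mathrm{hole}}(\mathcal{P})=1$ if $\mathrm{Box}(\mathcal{P})=\emptyset$; $\mu_{\mathrm{Ehr}}(\mathcal{P})$ = largest integer $i>0$ with $\delta_i\ne0$.
   Formalization: The dimension d is assumed at least 1, and the bound μ_hole ≤ d−1 is claimed only for d ≥ 2 (it fails for the segment [0,1], where μ_hole = 1); μ_Ehr is set to 1 when δ_i = 0 for all i > 0, where it is otherwise undefined. *)

(* Defs.v *)
From HB Require Import structures.
From mathcomp Require Import all_boot all_order all_algebra.
From mathcomp Require Import reals.
Set Implicit Arguments. Unset Strict Implicit. Unset Printing Implicit Defensive.
Import Order.TTheory GRing.Theory Num.Theory.
Local Open Scope ring_scope.

Section Polytopes.
Variables (R : realType) (N : nat).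

(* A polytope is given by a finite nonempty list W of lattice points of Z^N;
   it is conv(W) in R^N.  Lattice points are row vectors over int. *)
Definition emb (v : 'rV[int]_N) : 'rV[R]_N := map_mx (fun z : int => z%:~R) v.

Definition in_poly (W : seq 'rV[int]_N) (a : 'rV[int]_N) : Prop :=
  exists l : 'I_(size W) -> R,
    (forall i, 0 <= l i) /\ \sum_i l i = 1 /\ emb a = \sum_i l i *: emb W`_i.

(* dilation: k conv(W) = conv(k W) *)
Definition dil (k : nat) (W : seq 'rV[int]_N) : seq 'rV[int]_N :=
  [seq v *+ k | v <- W].

(* dimension of conv(W) = dimension of its affine hull *)
Definition dimP (W : seq 'rV[int]_N) : nat :=
  \rank (\matrix_(i < size W) (emb W`_i - emb W`_0)).

Definition decomp (W : seq 'rV[int]_N) (n : nat) (a : 'rV[int]_N) : Prop :=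
  exists f : 'I_n -> 'rV[int]_N, (forall i, in_poly W (f i)) /\ a = \sum_i f i.

Definition IDP (W : seq 'rV[int]_N) : Prop :=
  forall n : nat, (0 < n)%N -> forall a, in_poly (dil n W) a -> decomp W n a.

Definition very_ample (W : seq 'rV[int]_N) : Prop :=
  exists n0 : nat, forall n : nat, (n0 <= n)%N -> (0 < n)%N ->
    forall a, in_poly (dil n W) a -> decomp W n a.

(* integer points of Z^(N+1) are pairs (a, n), n being the degree *)
Definition lpt := ('rV[int]_N * int)%type.

(* (a, n) lies in the cone C(P) generated by the (v,1), v in W *)
Definition in_cone (W : seq 'rV[int]_N) (x : lpt) : Prop :=
  exists l : 'I_(size W) -> R,
    (forall i, 0 <= l i) /\ emb x.1 = \sum_i l i *: emb W`_i /\
    (x.2)%:~R = \sum_i l i.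

Definition zcomb (H : seq lpt) (x : lpt) : Prop :=
  exists c : 'I_(size H) -> nat,
    x.1 = \sum_(i < size H) (nth (0, 0) H i).1 *+ c i /\
    x.2 = \sum_(i < size H) (nth (0, 0) H i).2 *+ c i.

Definition hilbert_basis (W : seq 'rV[int]_N) (H : seq lpt) : Prop :=
  forall x, zcomb H x <-> in_cone W x.

Definition min_hilbert_basis (W : seq 'rV[int]_N) (H : seq lpt) : Prop :=
  hilbert_basis W H /\
  forall H' : seq lpt, {subset H' <= H} -> ~ {subset H <= H'} ->
    ~ hilbert_basis W H'.

Definition mu_hilb (W : seq 'rV[int]_N) (m : nat) : Prop :=
  (exists H, min_hilbert_basis W H) /\
  forall H, min_hilbert_basis W H ->
    (exists2 h, h \in H & h.2 = m%:Z) /\ (forall h, h \in H -> h.2 <= m%:Z).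

Definition empty_simplex (W : seq 'rV[int]_N) (e : nat)
    (f : 'I_e.+1 -> 'rV[int]_N) : Prop :=
  (forall i, in_poly W (f i)) /\
  \rank (\matrix_(i < e.+1) (emb (f i) - emb (f ord0))) = e /\
  (forall a, in_poly [seq f i | i <- enum 'I_e.+1] a -> exists i, a = f i).

Definition in_box_simplex (e : nat) (f : 'I_e.+1 -> 'rV[int]_N) (x : lpt)
    : Prop :=
  exists r : 'I_e.+1 -> R,
    (forall i, 0 <= r i < 1) /\ emb x.1 = \sum_i r i *: emb (f i) /\
    (x.2)%:~R = \sum_i r i.

Definition in_boxP (W : seq 'rV[int]_N) (x : lpt) : Prop :=
  (exists f, @empty_simplex W (dimP W) f /\ in_box_simplex f x) /\
  ~ (exists m : nat, x.2 = m%:Z /\ decomp W m x.1).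

Definition mu_hole (W : seq 'rV[int]_N) (m : nat) : Prop :=
  ((forall x, ~ in_boxP W x) /\ m = 1%N) \/
  ((exists x, in_boxP W x /\ x.2 = m%:Z) /\
   (forall x, in_boxP W x -> x.2 <= m%:Z)).

Definition has_card (T : eqType) (P : T -> Prop) (k : nat) : Prop :=
  exists s : seq T, uniq s /\ size s = k /\ forall a, a \in s <-> P a.

(* delta is the delta-vector (delta_0, ..., delta_d), d = dim P, extended by
   zeros: sum_n |nP cap Z^N| t^n = (sum_i delta_i t^i) / (1-t)^(d+1),
   i.e. |nP cap Z^N| = sum_(i <= min(n,d)) delta_i * C(n - i + d, d). *)
Definition is_delta (W : seq 'rV[int]_N) (delta : nat -> int) : Prop :=
  let d := dimP W in
  (forall i, (d < i)%N -> delta i = 0) /\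
  forall n : nat, exists k : nat,
    has_card (in_poly (dil n W)) k /\
    k%:Z = \sum_(i < d.+1 | (i <= n)%N) delta i * ('C(n - i + d, d))%:Z.

Definition mu_ehr (W : seq 'rV[int]_N) (m : nat) : Prop :=
  (exists delta, is_delta W delta) /\
  forall delta, is_delta W delta ->
    ((forall i, (0 < i)%N -> delta i = 0) /\ m = 1%N) \/
    [/\ (0 < m)%N, delta m != 0 & forall i, (m < i)%N -> delta i = 0].

End Polytopes.

Definition is_least (p : nat -> Prop) (m : nat) : Prop :=
  p m /\ forall k, p k -> (m <= k)%N.

(* Main.v *)
(* Work in the cone over P in R^(N+1), where a lattice point (a, n) has degree n.

   Every lattice point of the cone lies in the cone of an empty d-simplex of
   lattice points of P, hence is a box point p plus vertices of height one.  If
   k bounds the degrees of the box points that are not sums of height-one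
   points, such a p can be completed by k - deg p vertices to a point of kP, so
   kP has IDP; the same decomposition bounds the degrees of irreducible elements
   of the cone, which form the Hilbert basis.  For very ampleness with k the
   maximal degree of the Hilbert basis: write p as a sum of at most d
   irreducibles; when the degree is large, some vertex v occurs often enough to
   complete each irreducible to height k by copies of v.

   For the delta-vector, a generic cost vector yields a regular triangulation
   (dual feasible bases of a linear program), and a generic direction q makes
   the cones of its cells half-open and disjoint.  Then delta_i counts the
   half-open box points of degree i.  Choosing cost and direction so that a given
   empty simplex S is a cell with q in its interior, the whole box of S is
   counted; hence a box point of degree n forces delta_n <> 0. *)

Require Import Defs.
From HB Require Import structures.
From mathcomp Require Import all_boot all_order all_algebra.
From mathcomp Require Import boolp reals.
From mathcomp Require Import ring lra zify.
Set Implicit Arguments. Unset Strict Implicit. Unset Printing Implicit Defensive.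
Import Order.TTheory GRing.Theory Num.Theory.
Local Open Scope ring_scope.

(** * Cones, bases and regular triangulations *)

Section SimplicialCones.
Variables (R : realFieldType) (U : lmodType R) (I : finType) (w : I -> U).
Implicit Types (B : {set I}) (a l m : I -> R) (i j b : I).

Definition cmb l : U := \sum_i l i *: w i.
Definition supp B l := forall i, i \notin B -> l i = 0.
Definition indep B := forall l, supp B l -> cmb l = 0 -> forall i, l i = 0.
Definition tableau B (A : I -> I -> R) :=
  forall j, supp B (A j) /\ cmb (A j) = w j.
(** A basis of the span of the family [w], not of [U]: spanning is witnessed by coordinates for
    every generator. *)
Definition basis B := indep B /\ exists A, tableau B A.

Lemma cmb_lin l a t : cmb (fun i => l i + t * a i) = cmb l + t *: cmb a.
Proof.
rewrite /cmb scaler_sumr -big_split /=; apply: eq_bigr => i _.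
by rewrite scalerDl scalerA.
Qed.

Lemma eq_cmb l a : l =1 a -> cmb l = cmb a.
Proof. by move=> e; apply: eq_bigr => i _; rewrite e. Qed.

Lemma cmb_delta j : cmb (fun i => (i == j)%:R) = w j.
Proof.
rewrite /cmb (bigD1 j) //= eqxx scale1r big1 ?addr0 // => i /negbTE ->.
by rewrite scale0r.
Qed.

Lemma cmb_tableau B A l : tableau B A ->
  supp B (fun i => \sum_j l j * A j i) /\
  cmb (fun i => \sum_j l j * A j i) = cmb l.
Proof.
move=> tA; split=> [i iB|].
  by rewrite big1 // => j _; case: (tA j) => -> //; rewrite mulr0.
rewrite /cmb; under eq_bigr do rewrite scaler_suml.
rewrite exchange_big /=; apply: eq_bigr => j _; case: (tA j) => _ <-.
by rewrite /cmb scaler_sumr; apply: eq_bigr => i _; rewrite scalerA.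
Qed.

Lemma basis_span B l : basis B -> exists2 a, supp B a & cmb a = cmb l.
Proof. by case=> _ [A /(cmb_tableau l)[s e]]; eexists; eauto. Qed.

Lemma supp_lin B l a t :
  supp B l -> supp B a -> supp B (fun i => l i + t * a i).
Proof. by move=> sl sa i iB; rewrite sl // sa // mulr0 addr0. Qed.

Lemma coord_uniq B l a : indep B -> supp B l -> supp B a -> cmb l = cmb a ->
  l =1 a.
Proof.
move=> iB sl sa e i; apply/eqP; rewrite -subr_eq0; apply/eqP.
have := iB _ (supp_lin (-1) sl sa) _ i; rewrite mulN1r; apply.
by rewrite cmb_lin e scaleN1r subrr.
Qed.

(** Subtract [a] from [l] until a first coordinate reaches zero: that index minimises [l i / a i]
    over the positive entries of [a]. *)
Lemma ratio_test l a i0 : (forall i, 0 <= l i) -> 0 < a i0 ->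
  exists2 b, 0 < a b & forall i, 0 <= l i + - (l b / a b) * a i.
Proof.
move=> l0 a0; have [b ab bmin] :=
  @arg_minP _ R I i0 (fun i => 0 < a i) (fun i => l i / a i) a0.
exists b => // i; rewrite mulNr subr_ge0.
case: (ltP 0 (a i)) => ai; first by rewrite -ler_pdivlMr // bmin.
by apply: le_trans (l0 i); rewrite mulr_ge0_le0 // divr_ge0 // ltW.
Qed.

(* A spanning index set of minimal size carrying the point is a basis: a linear
   dependency would allow dropping one more index by the ratio test. *)
Lemma caratheodory l : (forall i, 0 <= l i) ->
  exists B l', [/\ basis B, supp B l', (forall i, 0 <= l' i) & cmb l' = cmb l].
Proof.
move=> l0; pose P B := `[< (exists A, tableau B A) /\ exists l',
  [/\ supp B l', (forall i, 0 <= l' i) & cmb l' = cmb l] >].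
have PT : P setT.
  apply/asboolP; split; last by exists l; split=> // i; rewrite in_setT.
  exists (fun j i => (i == j)%:R) => j; split; last exact: cmb_delta.
  by move=> i; rewrite in_setT.
case: (arg_minnP (fun B => #|B|) PT) => B /asboolP[[A tA] [l' [sl l'0 el]]] Bmin.
exists B, l'; split=> //; split; last by exists A.
(* The relation clears the index [b] from [l'] and from every row of the tableau, so [B :\ b] would
   still qualify. *)
have pos_dep a i0 : supp B a -> cmb a = 0 -> 0 < a i0 -> False.
  move=> sa ea a0; have [b ab brat] := ratio_test l'0 a0.
  have bB : b \in B by apply: contraLR ab => /sa ->; rewrite ltxx.
  suff /Bmin : P (B :\ b) by rewrite (cardsD1 b) bB ltnn.
  have ab0 : a b != 0 by rewrite gt_eqF.
  have sD m : supp B m -> supp (B :\ b) (fun i => m i + - (m b / a b) * a i).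
    move=> sm i; rewrite !inE negb_and negbK => /orP[/eqP->|iB].
      by rewrite mulNr divfK // subrr.
    by rewrite (sm i) // (sa i) // mulr0 addr0.
  apply/asboolP; split.
    exists (fun j i => A j i + - (A j b / a b) * a i) => j.
    case: (tA j) => sA eA; split; first exact: sD.
    by rewrite cmb_lin ea scaler0 addr0.
  exists (fun i => l' i + - (l' b / a b) * a i); split=> //; first exact: sD.
  by rewrite cmb_lin ea scaler0 addr0.
move=> a sa ea i; case: (ltgtP (a i) 0) => // ai; last by case: (pos_dep a i).
case: (pos_dep (fun i => 0 + (-1) * a i) i).
- by move=> k kB; rewrite sa // mulr0 addr0.
- rewrite (cmb_lin (fun=> 0)) ea scaler0 addr0 /cmb.
  by rewrite big1 // => k _; rewrite scale0r.
- by rewrite add0r mulN1r oppr_gt0.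
Qed.

(** The unit vector at [j] minus [a] is a relation with nonzero coefficient at [b]; adding multiples
    of it trades [b] for [j] without changing [cmb]. *)
Lemma basis_exchange B a j b : basis B -> supp B a -> cmb a = w j ->
  j \notin B -> b \in B -> a b != 0 -> basis (j |: B :\ b).
Proof.
move=> [iB [A tA]] sa ea jB bB ab0.
have bj : (b == j) = false by apply: contraNF jB => /eqP <-.
have cd t m : cmb (fun i => m i + t * ((i == j)%:R + (-1) * a i)) = cmb m.
  by rewrite cmb_lin cmb_lin cmb_delta ea scaleN1r subrr scaler0 addr0.
split=> [m sm em|].
  have sn : supp B (fun i => m i + - m j * ((i == j)%:R + (-1) * a i)).
    move=> i iB'; case: (eqVneq i j) => [->|ij]; last first.
      rewrite (sm i) ?(sa i) ?(negbTE ij) //; first by rewrite mulr0 addr0 mulr0 addr0.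
      by rewrite !inE (negbTE ij) (negbTE iB') andbF.
    by rewrite (sa j) // mulr0 addr0 mulr1 subrr.
  have n0 := iB _ sn (etrans (cd _ _) em).
  have mb : m b = 0 by rewrite sm // !inE bj eqxx.
  have mj : m j = 0.
    have := n0 b; rewrite mb bj add0r add0r mulN1r mulrNN => /eqP.
    by rewrite mulf_eq0 (negbTE ab0) orbF => /eqP.
  by move=> i; have := n0 i; rewrite mj oppr0 mul0r addr0.
exists (fun k i => A k i + (A k b / a b) * ((i == j)%:R + (-1) * a i)) => k.
case: (tA k) => sA eA; split; last by rewrite cd.
move=> i; rewrite !inE negb_or => /andP[/negbTE-> ]; rewrite negb_and negbK.
case/orP=> [/eqP->|iB']; first by rewrite add0r mulN1r mulrN divfK // subrr.
by rewrite (sA i) // (sa i) // mulr0 addr0 mulr0 addr0.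
Qed.

(** The simplex pivot: [j] enters, and the ratio test picks the leaving index so that the
    coordinates stay nonnegative. *)
Lemma pivot B l a j i0 : basis B -> supp B l -> (forall i, 0 <= l i) ->
  supp B a -> cmb a = w j -> j \notin B -> 0 < a i0 ->
  exists b, let B' := j |: B :\ b in
    let l' i := l i + (l b / a b) * ((i == j)%:R + (-1) * a i) in
  [/\ b \in B /\ 0 < a b, basis B', supp B' l', (forall i, 0 <= l' i)
    & cmb l' = cmb l].
Proof.
move=> bB sl l0 sa ea jB a0; have [b ab brat] := ratio_test l0 a0.
have bB' : b \in B by apply: contraLR ab => /sa ->; rewrite ltxx.
have ab0 : a b != 0 by rewrite gt_eqF.
exists b; split=> //=; first exact: (basis_exchange bB sa ea jB bB').
- move=> i; rewrite !inE negb_or => /andP[/negbTE-> ]; rewrite negb_and negbK.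
  case/orP=> [/eqP->|iB']; first by rewrite add0r mulN1r mulrN divfK // subrr.
  by rewrite (sl i) // (sa i) // mulr0 addr0 mulr0 addr0.
- move=> i; have : 0 <= l b / a b * (i == j)%:R.
    by rewrite mulr_ge0 // divr_ge0 // ltW.
  by have := brat i; lra.
- by rewrite cmb_lin cmb_lin cmb_delta ea scaleN1r subrr scaler0 addr0.
Qed.

(** * Regular triangulations and their half-open cells *)

Section Triangulation.
Variable c : I -> R.
Hypothesis c_ge0 : forall i, 0 <= c i.
Hypothesis c_gen : forall B j a, basis B -> j \notin B -> supp B a ->
  cmb a = w j -> \sum_i a i * c i != c j.

(* Dual feasibility for the linear program: minimise the cost [c] of a
   nonnegative combination representing a given point.  The dual feasible bases
   are the maximal cells of a regular triangulation. *)
Definition dualf B := forall j a, j \notin B -> supp B a -> cmb a = w j ->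
  \sum_i a i * c i < c j.

(** Among the bases in which [y] has nonnegative coordinates, one of least cost is dual feasible:
    otherwise a pivot lowers the cost, strictly since no basis coordinate of [y] vanishes. *)
Lemma dualf_exists y l0 :
  (forall B a, basis B -> supp B a -> cmb a = y ->
     forall i, i \in B -> a i != 0) ->
  (forall i, 0 <= l0 i) -> cmb l0 = y ->
  exists B l, [/\ basis B, dualf B, supp B l, (forall i, i \in B -> 0 < l i)
                & cmb l = y].
Proof.
move=> ygen l00 el0.
have [B0 [l1 [bB0 sl1 l10 el1]]] := caratheodory l00.
have /choice[L LP] : forall B, exists l, basis B -> supp B l /\ cmb l = y.
  move=> B; case: (pselect (basis B)) => [bB|]; last by exists (fun=> 0).
  by have [l sl el] := basis_span l0 bB; exists l; rewrite el el0.
pose F B := `[< basis B /\ forall i, 0 <= L B i >].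
have FB0 : F B0.
  apply/asboolP; split=> // i; have [sl el] := LP B0 bB0.
  by rewrite (coord_uniq bB0.1 sl sl1) // el el1.
have [B /asboolP[bB LB0] Bmin] :=
  @arg_minP _ R _ B0 F (fun B => \sum_i L B i * c i) FB0.
have [sL eL] := LP B bB.
have Lpos i : i \in B -> 0 < L B i.
  by move=> iB; rewrite lt_def LB0 andbT (ygen B).
exists B, (L B); split=> // j a jB sa ea.
case: (ltgtP (\sum_i a i * c i) (c j)) => // [cj|/eqP]; last first.
  by rewrite (negbTE (c_gen bB jB sa ea)).
(* The cost of [a] exceeds [c j], which is nonnegative, so [a] has a positive entry. *)
have [i0 ai0] : exists i0, 0 < a i0.
  apply: contrapT => /forallNP na; have : \sum_i a i * c i <= 0.
    apply: sumr_le0 => i _; rewrite mulr_le0_ge0 //.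
    by rewrite leNgt; apply/negP/na.
  by have := c_ge0 j; lra.
have [b [[bB' ab] bB1 sl' l'0 el']] := pivot bB sL LB0 sa ea jB ai0.
set B' := (j |: B :\ b) in bB1 sl'.
have [sL' eL'] := LP B' bB1.
have LE := coord_uniq bB1.1 sL' sl' (etrans eL' (esym (etrans el' eL))).
have /Bmin : F B' by apply/asboolP; split=> // i; rewrite LE.
have -> : \sum_i L B' i * c i = \sum_i L B i * c i
    + (L B b / a b) * (c j - \sum_i a i * c i).
  rewrite (eq_bigr _ (fun i _ => congr1 (fun z => z * c i) (LE i))).
  have -> : c j = \sum_i (i == j)%:R * c i.
    rewrite (bigD1 j) //= eqxx mul1r big1 ?addr0 // => i /negbTE->.
    by rewrite mul0r.
  rewrite -sumrB mulr_sumr -big_split; apply: eq_bigr => i _ /=.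
  by ring.
have := divr_gt0 (Lpos b bB') ab => th.
have : L B b / a b * (c j - \sum_i a i * c i) < 0.
  by rewrite pmulr_rlt0 // subr_lt0.
by lra.
Qed.

(** Rewriting [l'] in the basis [B] replaces each [w j] by a combination of cost at most [c j], with
    equality exactly for [j] in [B]. *)
Lemma dualf_cost_le B B' l l' : basis B -> dualf B -> supp B l ->
  supp B' l' -> (forall i, i \in B' -> 0 < l' i) -> cmb l = cmb l' ->
  \sum_i l i * c i <= \sum_i l' i * c i ?= iff (B' \subset B).
Proof.
move=> bB dB sl sl' l'0 e; have [iB [A tA]] := bB.
have [sA eA] := cmb_tableau l' tA.
have lE := coord_uniq iB sl sA (etrans e (esym eA)).
have -> : \sum_i l i * c i = \sum_j l' j * \sum_i A j i * c i.
  rewrite (eq_bigr _ (fun i _ => congr1 (fun z => z * c i) (lE i))).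
  under eq_bigr do rewrite mulr_suml.
  rewrite exchange_big /=; apply: eq_bigr => j _; rewrite mulr_sumr.
  by apply: eq_bigr => i _; rewrite mulrA.
have -> : (B' \subset B) = [forall j, (j \in B') ==> (j \in B)].
  by apply/subsetP/forallP => [s j|s j]; [apply/implyP/s|apply/implyP/s].
apply: leif_sum => j _; case: (boolP (j \in B)) => jB; rewrite ?implybT.
  have -> : \sum_i A j i * c i = c j; last exact/leif_refl.
  have Ad : A j =1 (fun i => (i == j)%:R).
    apply: (coord_uniq iB); [by case: (tA j)| |by rewrite cmb_delta; case: (tA j)].
    by move=> i; case: eqP => // -> /negP.
  rewrite (bigD1 j) //= Ad eqxx mul1r big1 ?addr0 // => i /negbTE ij.
  by rewrite Ad ij mul0r.
rewrite implybF; case: (boolP (j \in B')) => jB' /=; last first.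
  by rewrite sl' // !mul0r; exact/leif_refl.
have lt : l' j * \sum_i A j i * c i < l' j * c j.
  by rewrite ltr_pM2l ?l'0 //; case: (tA j) => sj ej; apply: dB.
by split; [exact: ltW|rewrite lt_eqF].
Qed.

Lemma dualf_unique B B' l l' : basis B -> dualf B -> supp B l ->
  (forall i, i \in B -> 0 < l i) -> basis B' -> dualf B' -> supp B' l' ->
  (forall i, i \in B' -> 0 < l' i) -> cmb l = cmb l' -> B = B'.
Proof.
move=> bB dB sl l0 bB' dB' sl' l'0 e.
have h1 := dualf_cost_le bB dB sl sl' l'0 e.
have h2 := dualf_cost_le bB' dB' sl' sl l0 (esym e).
have E := le_anti (introT andP (conj h1.1 h2.1)).
by apply/eqP; rewrite eqEsubset -h1.2 -h2.2 E eqxx.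
Qed.

(** Makes an infinitesimal concrete: a perturbation of size [e] never flips the sign of a nonzero
    entry. *)
Lemma small_eps (K : finType) (l m : K -> R) :
  exists2 e, 0 < e & forall k, l k != 0 -> e * `|m k| < `|l k|.
Proof.
pose g k := if l k == 0 then 1 else `|l k| / (`|m k| + 1).
have m1 k : 0 < `|m k| + 1 by have := normr_ge0 (m k); lra.
have g0 k : 0 < g k.
  by rewrite /g; case: eqP => // /eqP lk; rewrite divr_gt0 ?normr_gt0.
exists (\big[Order.min/1]_k g k).
  by elim/big_ind: _ => // x y x0 y0; rewrite lt_min x0.
move=> k lk; have : \big[Order.min/1]_k g k <= g k by exact: bigmin_le.
rewrite {2}/g (negbTE lk) => le.
apply: le_lt_trans (ler_wpM2r (normr_ge0 _) le) _.
by rewrite mulrAC ltr_pdivrMr // ltr_pM2l ?normr_gt0 //; lra.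
Qed.

Variable q : U.
Hypothesis q_gen : forall B m, basis B -> supp B m -> cmb m = q ->
  forall i, i \in B -> m i != 0.

(* The half-open cell of [B]: points [x] such that [x + e q] is interior to the
   cone of [B] for all small [e > 0]; [l] and [m] are the coordinates of [x] and
   [q] in [B]. *)
Record half_open x B l m : Prop := HalfOpen {
  ho_basis : basis B;
  ho_dual : dualf B;
  ho_supp : supp B l;
  ho_cmb : cmb l = x;
  ho_qsupp : supp B m;
  ho_qcmb : cmb m = q;
  ho_pos : forall i, i \in B -> 0 < l i \/ (l i = 0 /\ 0 < m i) }.

(** For small [e] no basis coordinate of [x + e q] vanishes, so [dualf_exists] applies to it; the
    signs of its coordinates are read lexicographically from those of [x] and [q]. *)
Lemma half_open_exists x s l0 : (forall i, 0 <= s i) -> cmb s = q ->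
  (forall i, 0 <= l0 i) -> cmb l0 = x -> exists B l m, half_open x B l m.
Proof.
move=> s0 es l00 el0.
have coordsP y r : cmb r = y ->
    exists L, forall B, basis B -> supp B (L B) /\ cmb (L B) = y.
  move=> er; have /choice[L LP] : forall B, exists l,
      basis B -> supp B l /\ cmb l = y; last by exists L.
  move=> B; case: (pselect (basis B)) => [bB|]; last by exists (fun=> 0).
  by have [l sl el] := basis_span r bB; exists l; rewrite el er.
have [L LP] := coordsP _ _ el0; have [M MP] := coordsP _ _ es.
(* One [e] has to serve all bases at once, hence the pairs. *)
have [e e0 ep] := small_eps (fun k : {set I} * I => L k.1 k.2) (fun k => M k.1 k.2).
have bnd B i : L B i != 0 -> - `|L B i| < e * M B i < `|L B i|.
  by move=> /(ep (B, i)) /=; rewrite -{1}(gtr0_norm e0) -normrM ltr_norml.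
have cmbE B : basis B -> cmb (fun i => L B i + e * M B i) = x + e *: q.
  by move=> bB; rewrite cmb_lin; case: (LP B bB) (MP B bB) => _ -> [_ ->].
have suppE B : basis B -> supp B (fun i => L B i + e * M B i).
  by move=> bB; case: (LP B bB) (MP B bB) => ? _ [? _]; exact: supp_lin.
have gen B a : basis B -> supp B a -> cmb a = x + e *: q ->
    forall i, i \in B -> a i != 0.
  move=> bB sa ea i iB; rewrite (coord_uniq bB.1 sa (suppE _ bB)) ?cmbE //.
  have Mi : M B i != 0 by case: (MP B bB) => sM eM; apply: q_gen eM _ iB.
  case: (eqVneq (L B i) 0) => [->|/(bnd B i)/andP[h1 h2]].
    by rewrite add0r mulf_neq0 // gt_eqF.
  apply/eqP => E; have E' : e * M B i = - L B i by lra.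
  by move: h1 h2; rewrite E'; case: (ger0P (L B i)) => _; lra.
have ge0 i : 0 <= l0 i + e * s i by rewrite addr_ge0 // mulr_ge0 // ltW.
have [|B [l [bB dB sl l0p el]]] := dualf_exists gen ge0.
  by rewrite cmb_lin el0 es.
exists B, (L B), (M B); case: (LP B bB) (MP B bB) => sL eL [sM eM]; split=> //.
move=> i iB; have := l0p i iB.
rewrite (coord_uniq bB.1 sl (suppE _ bB)) ?cmbE // => p.
case: (eqVneq (L B i) 0) p => [->|Li p].
  by rewrite add0r pmulr_rgt0 //; right.
left; move: (bnd _ _ Li) => /andP[h1 h2].
move: p h1 h2; case: (ltgtP (L B i) 0) Li => // Li _; rewrite (ltr0_norm Li); lra.
Qed.

(** For a common small [e] the point [x + e q] is interior to both cells, and [dualf_unique]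
    applies. *)
Lemma half_open_unique x B l m B' l' m' :
  half_open x B l m -> half_open x B' l' m' -> B = B'.
Proof.
case=> bB dB sl el sm em pos [bB' dB' sl' el' sm' em' pos'].
have [e e0 ep] := small_eps (fun k : bool * I => if k.1 then l k.2 else l' k.2)
   (fun k => if k.1 then m k.2 else m' k.2).
have main (u v : R) : (u != 0 -> e * `|v| < `|u|) -> 0 < u \/ (u = 0 /\ 0 < v) ->
    0 < u + e * v.
  move=> h [u0|[-> v0]]; last by rewrite add0r mulr_gt0.
  have := h (lt0r_neq0 u0); rewrite -{1}(gtr0_norm e0) -normrM ltr_norml.
  by rewrite (gtr0_norm u0) => /andP[]; lra.
apply: (@dualf_unique B B' (fun i => l i + e * m i) (fun i => l' i + e * m' i)) => //.
- exact: supp_lin.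
- by move=> i iB; apply: main (ep (true, i)) (pos i iB).
- exact: supp_lin.
- by move=> i iB; apply: main (ep (false, i)) (pos' i iB).
- by rewrite !cmb_lin el el' em em'.
Qed.

End Triangulation.

(** * Generic costs and directions, by avoiding roots of polynomials *)

Lemma nonroot (K : finType) (p : K -> {poly R}) : (forall k, p k != 0) ->
  exists2 t, 0 < t & forall k, (p k).[t] != 0.
Proof.
move=> p0; pose P := \prod_k p k.
have P0 : P != 0 by apply/prodf_neq0 => k _.
(* These positive integers outnumber the roots of [P]. *)
pose rs := [seq n.+1%:R : R | n <- iota 0 (size P)].
have urs : uniq rs.
  rewrite map_inj_uniq ?iota_uniq // => m n /eqP.
  by rewrite eqr_nat eqSS => /eqP.
case: (boolP (all (root P) rs)) => [ars|/allPn[t]].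
  by have := max_poly_roots P0 ars urs; rewrite size_map size_iota ltnn.
case/mapP=> n _ -> nr; exists n.+1%:R; first by rewrite ltr0n.
move=> k; apply: contra nr => /eqP e.
by rewrite rootE /P (bigD1 k) //= hornerM e mul0r.
Qed.

(** Take powers of one parameter [t] as coordinates on [S]. Each coordinate in a basis [B] is then a
    polynomial in [t]; if the one at [i] were zero, then, [S] being spanning, [w i] itself would
    have coordinate 0 at [i]. *)
Lemma generic_direction (S : {set I}) : basis S ->
  exists s, [/\ forall i, i \in S -> 0 < s i, supp S s
     & forall B m, basis B -> supp B m -> cmb m = cmb s ->
         forall i, i \in B -> m i != 0].
Proof.
move=> bS.
have /choice[A AP] : forall B, exists A, basis B -> tableau B A.
  move=> B; case: (pselect (basis B)) => [[_ [A tA]]|]; first by exists A.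
  by exists (fun _ _ => 0).
pose P (k : {set I} * I) : {poly R} :=
  if `[< basis k.1 /\ k.2 \in k.1 >]
  then \sum_(j in S) A k.1 j k.2 *: 'X^(enum_rank j) else 1.
have P0 k : P k != 0.
  rewrite /P; case: asboolP => [[bB iB]|_]; last exact: oner_neq0.
  case: k bB iB => B i /= bB iB; apply/eqP => e.
  have tA := AP B bB.
  have z j : j \in S -> A B j i = 0.
    move=> jS; have := congr1 (fun p : {poly R} => p`_(enum_rank j)) e.
    rewrite coef0 coef_sum (bigD1 j) //= coefZ coefXn eqxx mulr1 big1 ?addr0 //.
    move=> k /andP[_ kj]; rewrite coefZ coefXn; case: eqP; rewrite ?mulr0 //.
    by move=> /val_inj/enum_rank_inj jk; rewrite jk eqxx in kj.
  have [iS [T tT]] := bS; have [sT eT] := tT i.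
  have [sC eC] := cmb_tableau (T i) tA.
  have sd : supp B (fun k => (k == i)%:R).
    by move=> k; case: eqP => // -> /negP.
  have := coord_uniq bB.1 sC sd (etrans eC (etrans eT (esym (cmb_delta i)))) i.
  rewrite eqxx big1 => [/eqP|j _]; first by rewrite eq_sym oner_eq0.
  by case: (boolP (j \in S)) => jS; [rewrite z // mulr0|rewrite sT // mul0r].
have [t t0 tP] := nonroot P0.
exists (fun j => if j \in S then t ^+ enum_rank j else 0); split.
- by move=> i ->; rewrite exprn_gt0.
- by move=> i /negbTE->.
move=> B m bB sm em i iB.
have [sC eC] := cmb_tableau (fun j => if j \in S then t ^+ enum_rank j else 0) (AP B bB).
rewrite (coord_uniq bB.1 sm sC) ?eC //.
have := tP (B, i); rewrite /P /=; case: asboolP => [_|[]//].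
rewrite horner_sum; congr (_ != 0); rewrite big_mkcond; apply: eq_bigr => j _.
by case: ifP => jS; rewrite ?mul0r // !hornerE mulrC.
Qed.

(** Cost 0 on [S] and powers of [t] off [S] make [S] dual feasible for every positive [t]. A tie at
    [B], [j] is a polynomial equation in [t]; were it an identity, independence of [S] would give
    [w j] coordinate 1 at [j], although [j] is outside [B]. *)
Lemma generic_cost (S : {set I}) : basis S ->
  exists c, [/\ (forall i, 0 <= c i), dualf c S
     & forall B j a, basis B -> j \notin B -> supp B a -> cmb a = w j ->
         \sum_i a i * c i != c j].
Proof.
move=> bS.
have /choice[A AP] : forall B, exists A, basis B -> tableau B A.
  move=> B; case: (pselect (basis B)) => [[_ [A tA]]|]; first by exists A.
  by exists (fun _ _ => 0).
pose mon j : {poly R} := if j \in S then 0 else 'X^(enum_rank j).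
pose P (k : {set I} * I) : {poly R} :=
  if `[< basis k.1 /\ k.2 \notin k.1 >]
  then \sum_i A k.1 k.2 i *: mon i - mon k.2 else 1.
have cm i j : j \notin S -> (mon i)`_(enum_rank j) = (i == j)%:R.
  move=> jS; rewrite /mon; case: ifP => iS.
    by rewrite coef0; case: eqP => // ij; rewrite -ij iS in jS.
  rewrite coefXn eq_sym; congr (nat_of_bool _)%:R; apply/eqP/eqP => [|->//].
  by move/val_inj/enum_rank_inj.
have P0 k : P k != 0.
  rewrite /P; case: asboolP => [[bB iB]|_]; last exact: oner_neq0.
  case: k bB iB => B j /= bB jB; apply/eqP => e.
  have [sA eA] := AP B bB j.
  have z i : i \notin S -> A B j i = (j == i)%:R.
    move=> iS; have := congr1 (fun p : {poly R} => p`_(enum_rank i)) e.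
    rewrite coef0 coefB cm // coef_sum (bigD1 i) //= coefZ cm // eqxx mulr1.
    rewrite big1 ?addr0 => [/eqP|k /negbTE ki]; first by rewrite subr_eq0 => /eqP.
    by rewrite coefZ cm // ki mulr0.
  case: (boolP (j \in S)) => jS; last first.
    by have := z _ jS; rewrite sA // eqxx => /eqP; rewrite eq_sym oner_eq0.
  have sAS : supp S (A B j).
    by move=> i iS; rewrite z //; case: eqP => // ji; rewrite -ji jS in iS.
  have sd : supp S (fun k => (k == j)%:R).
    by move=> k; case: eqP => // -> /negP.
  have := coord_uniq bS.1 sAS sd (etrans eA (esym (cmb_delta j))) j.
  by rewrite sA // eqxx => /eqP; rewrite eq_sym oner_eq0.
have [t t0 tP] := nonroot P0.
have monE j : (mon j).[t] = if j \in S then 0 else t ^+ enum_rank j.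
  by rewrite /mon; case: ifP => _; rewrite !hornerE.
exists (fun j => (mon j).[t]); split.
- by move=> i; rewrite monE; case: ifP => // _; rewrite exprn_ge0 // ltW.
- move=> j a jS sa ea; rewrite big1 => [|i _]; last first.
    by case: (boolP (i \in S)) => iS; [rewrite monE iS mulr0|rewrite sa // mul0r].
  by rewrite monE (negbTE jS) exprn_gt0.
move=> B j a bB jB sa ea; have [sA eA] := AP B bB j.
have := tP (B, j); rewrite /P /=; case: asboolP => [_|[]//].
rewrite hornerD hornerN subr_eq0 horner_sum; congr (_ != _).
apply: eq_bigr => i _; rewrite hornerZ; congr (_ * _).
by apply: (coord_uniq bB.1 sA sa); rewrite eA ea.
Qed.

End SimplicialCones.

(** * Homogenization *)

Section Homogenization.
Variables (R : realType) (N : nat).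
Implicit Types (x y : lpt N) (a b : 'rV[int]_N) (W : seq 'rV[int]_N).

Definition hom (x : lpt N) : 'rV[R]_(N + 1) :=
  row_mx (emb R x.1) (const_mx x.2%:~R).

Definition pt a : lpt N := (a, 1).

Lemma embD a b : emb R (a + b) = emb R a + emb R b.
Proof. by apply/rowP => i; rewrite !mxE intrD. Qed.

Lemma homD x y : hom (x + y) = hom x + hom y.
Proof.
rewrite /hom add_row_mx embD; congr row_mx.
by apply/rowP => i; rewrite !mxE intrD.
Qed.

Lemma hom0 : hom 0 = 0.
Proof. by apply: (addrI (hom 0)); rewrite -homD !addr0. Qed.

Lemma homN x : hom (- x) = - hom x.
Proof. by apply: (addrI (hom x)); rewrite -homD !subrr hom0. Qed.

Lemma homMn x k : hom (x *+ k) = k%:R *: hom x.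
Proof.
elim: k => [|k IH]; first by rewrite mulr0n hom0 scale0r.
by rewrite mulrS homD IH -natr1 scalerDl scale1r addrC.
Qed.

Lemma hom_sum (I : Type) (r : seq I) (P : pred I) (F : I -> lpt N) :
  hom (\sum_(i <- r | P i) F i) = \sum_(i <- r | P i) hom (F i).
Proof. exact: (big_morph hom homD hom0). Qed.

Lemma hom_inj : injective hom.
Proof.
case=> a m [b n] /eq_row_mx[/= e1 e2]; congr pair.
  by apply/rowP => i; move/rowP/(_ i): e1; rewrite !mxE => /eqP; rewrite eqr_int => /eqP.
by move/rowP/(_ 0): e2; rewrite !mxE => /eqP; rewrite eqr_int => /eqP.
Qed.

Definition hdeg (u : 'rV[R]_(N + 1)) : R := u 0 (rshift N 0).

Lemma hdeg_hom x : hdeg (hom x) = x.2%:~R.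
Proof. by rewrite /hdeg row_mxEr mxE. Qed.

Lemma hdeg_cmb (I : finType) (v : I -> 'rV[int]_N) (l : I -> R) :
  hdeg (cmb (fun i => hom (pt (v i))) l) = \sum_i l i.
Proof.
rewrite /hdeg /cmb summxE; apply: eq_bigr => i _.
by rewrite mxE -/(hdeg _) hdeg_hom mulr1.
Qed.

(** Merges the lattice equation and the degree equation of the definitions into one linear equation,
    to which the results on [cmb] apply. *)
Lemma cmb_homP (I : finType) (v : I -> 'rV[int]_N) (l : I -> R) x :
  cmb (fun i => hom (pt (v i))) l = hom x <->
  emb R x.1 = \sum_i l i *: emb R (v i) /\ x.2%:~R = \sum_i l i.
Proof.
have -> : cmb (fun i => hom (pt (v i))) l =
    row_mx (\sum_i l i *: emb R (v i)) (const_mx (\sum_i l i)).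
  rewrite -[LHS]hsubmxK; congr row_mx.
    rewrite /cmb linear_sum /=; apply: eq_bigr => i _.
    by rewrite linearZ /= row_mxKl.
  by apply/rowP => k; rewrite ord1 !mxE -(hdeg_cmb v).
split=> [/eq_row_mx[e1 e2]|[e1 e2]]; last by rewrite /hom -e1 -e2.
by split=> //; move/rowP/(_ 0): e2; rewrite !mxE.
Qed.

Lemma in_coneP W x : in_cone R W x <-> exists2 l : 'I_(size W) -> R,
  (forall i, 0 <= l i) & cmb (fun i : 'I_(size W) => hom (pt W`_i)) l = hom x.
Proof.
split=> [[l [l0 /cmb_homP e]]|[l l0 /cmb_homP e]]; first by exists l.
by exists l; split.
Qed.

Lemma in_polyE W m a : size W = m -> in_poly R W a <->
  exists l : 'I_m -> R, (forall i, 0 <= l i) /\ \sum_i l i = 1 /\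
    emb R a = \sum_(i < m) l i *: emb R W`_i.
Proof. by move=> <-. Qed.

Lemma in_poly_cone W a : in_poly R W a <-> in_cone R W (pt a).
Proof.
split=> [[l [l0 [s e]]]|[l [l0 [e s]]]]; exists l; split=> //; split=> //=.
Qed.

Lemma in_poly_family n (f : 'I_n.+1 -> 'rV[int]_N) a :
  in_poly R [seq f i | i <- enum 'I_n.+1] a <->
  exists2 l : 'I_n.+1 -> R, (forall i, 0 <= l i) &
    cmb (fun i => hom (pt (f i))) l = hom (pt a).
Proof.
have sz : size [seq f i | i <- enum 'I_n.+1] = n.+1.
  by rewrite size_map size_enum_ord.
have nthE (i : 'I_n.+1) : [seq f i | i <- enum 'I_n.+1]`_i = f i.
  by rewrite (nth_map ord0) ?size_enum_ord // nth_ord_enum.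
split=> [/(in_polyE _ sz)[l [l0 [s e]]]|[l l0 /cmb_homP[/= e s]]].
  exists l => //; apply/cmb_homP; split=> //=.
  by rewrite e; apply: eq_bigr => i _; rewrite nthE.
apply/(in_polyE _ sz); exists l; split=> //; split=> //.
by rewrite e; apply: eq_bigr => i _; rewrite nthE.
Qed.

Lemma embMn a n : emb R (a *+ n) = n%:R *: emb R a.
Proof. by apply/rowP => i; rewrite !mxE mulmxnE rmorphMn /= mulr_natl. Qed.

Lemma cone_deg_ge0 W x : in_cone R W x -> 0 <= x.2.
Proof.
case=> l [l0 [_ e]]; rewrite -(ler_int R) e; exact: sumr_ge0.
Qed.

Lemma cone_deg0 W x : in_cone R W x -> x.2 = 0 -> x = 0.
Proof.
case: x => a n [l [l0 [/= e s]]] n0; rewrite n0 in s *; congr pair.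
have l00 i : l i = 0.
  move/esym/eqP: s; rewrite psumr_eq0 // => /allP/(_ i (mem_index_enum i)).
  by move=> /eqP.
have : emb R a = 0 by rewrite e big1 // => i _; rewrite l00 scale0r.
move=> ea; apply/rowP => i; move/rowP/(_ i): ea; rewrite !mxE.
by move=> /eqP; rewrite intr_eq0 => /eqP.
Qed.

Lemma in_poly_dil W n a : W != [::] ->
  in_poly R (dil n W) a <-> in_cone R W (a, n%:Z).
Proof.
move=> W0; have sz : size (dil n W) = size W by rewrite size_map.
have nthE (i : 'I_(size W)) : emb R (dil n W)`_i = n%:R *: emb R W`_i.
  by rewrite (nth_map 0) // embMn.
split=> [/(in_polyE _ sz)[l [l0 [s e]]]|Ca].
  exists (fun i => n%:R * l i); split=> [i|]; first by rewrite mulr_ge0.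
  rewrite -mulr_sumr s mulr1; split=> //=.
  by rewrite e; apply: eq_bigr => i _; rewrite nthE scalerA mulrC.
apply/(in_polyE _ sz); case: n Ca sz nthE => [|n] Ca sz nthE.
  (* In degree 0 one cannot divide by the degree; the point is the origin, and weight 1 on the first
     vertex represents it. *)
  have -> : a = 0 by have /(congr1 fst) := cone_deg0 Ca erefl.
  have W1 : (0 < size W)%N by rewrite lt0n size_eq0.
  exists (fun i => (i == Ordinal W1)%:R); split=> //; split.
    by rewrite (bigD1 (Ordinal W1)) //= ?eqxx big1 ?addr0 // => i /negbTE->.
  rewrite big1 => [|i _]; last by rewrite nthE scale0r scaler0.
  by apply/rowP => i; rewrite !mxE.
case: Ca => l [l0 [/= e s]].
have n0 : n.+1%:R != 0 :> R by rewrite pnatr_eq0.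
exists (fun i => l i / n.+1%:R); split=> [i|]; first by rewrite divr_ge0.
rewrite -mulr_suml -s; split; first by rewrite divff.
by rewrite e; apply: eq_bigr => i _; rewrite nthE scalerA divfK.
Qed.

Lemma cone0 W : in_cone R W 0.
Proof.
apply/in_coneP; exists (fun=> 0) => //; rewrite hom0 /cmb big1 // => i _.
by rewrite scale0r.
Qed.

Lemma coneD W x y : in_cone R W x -> in_cone R W y -> in_cone R W (x + y).
Proof.
move=> /in_coneP[l l0 e] /in_coneP[m m0 e']; apply/in_coneP.
exists (fun i => l i + 1 * m i) => [i|]; first by rewrite mul1r addr_ge0.
by rewrite cmb_lin e e' scale1r homD.
Qed.

Lemma cone_sum W (I : Type) (r : seq I) (P : pred I) (F : I -> lpt N) :
  (forall i, P i -> in_cone R W (F i)) -> in_cone R W (\sum_(i <- r | P i) F i).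
Proof.
by move=> h; elim/big_ind: _ => //; [exact: cone0|move=> ? ?; exact: coneD].
Qed.

Lemma coneMn W x k : in_cone R W x -> in_cone R W (x *+ k).
Proof.
by move=> Cx; elim: k => [|k IH]; rewrite ?mulrS; [exact: cone0|exact: coneD].
Qed.

Lemma cone_mem W a : a \in W -> in_cone R W (pt a).
Proof.
move=> /(nthP 0)[i iW <-]; apply/in_coneP.
exists (fun j => (j == Ordinal iW)%:R) => //.
by rewrite (cmb_delta (fun i : 'I_(size W) => hom (pt W`_i))).
Qed.

Lemma cone_cmb W (I : finType) (v : I -> 'rV[int]_N) (l : I -> R) x :
  (forall i, in_cone R W (pt (v i))) -> (forall i, 0 <= l i) ->
  cmb (fun i => hom (pt (v i))) l = hom x -> in_cone R W x.
Proof.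
move=> Cv l0 e.
have /choice[A AP] : forall i, exists m : 'I_(size W) -> R,
    (forall k, 0 <= m k) /\ cmb (fun k : 'I_(size W) => hom (pt W`_k)) m = hom (pt (v i)).
  by move=> i; have /in_coneP[m m0 em] := Cv i; exists m.
apply/in_coneP; exists (fun k => \sum_i l i * A i k).
  by move=> k; apply: sumr_ge0 => i _; rewrite mulr_ge0 //; case: (AP i).
rewrite -e /cmb; under eq_bigr do rewrite scaler_suml.
rewrite exchange_big /=; apply: eq_bigr => i _; case: (AP i) => _ <-.
by rewrite /cmb scaler_sumr; apply: eq_bigr => k _; rewrite scalerA.
Qed.

Lemma cone_cover W (I : finType) (v : I -> 'rV[int]_N) x :
  (forall a, a \in W -> exists i, v i = a) -> in_cone R W x ->
  exists2 l : I -> R, (forall i, 0 <= l i) &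
    cmb (fun i => hom (pt (v i))) l = hom x.
Proof.
move=> Wv Cx; have /choice[h hE] : forall k : 'I_(size W), exists i, v i = W`_k.
  by move=> k; apply: Wv; exact: mem_nth.
have /in_coneP[r r0 <-] := Cx.
(* Coefficients of positions sent to the same index are added up. *)
exists (fun i => \sum_(k | h k == i) r k) => [i|]; first exact: sumr_ge0.
rewrite /cmb (partition_big h predT) //=; apply: eq_bigr => i _.
by rewrite scaler_suml; apply: eq_bigr => k /eqP <-; rewrite hE.
Qed.

(** The coefficients of a degree [n] point sum to [n], so its coordinates are bounded by [K];
    filtering the box of integer vectors with entries between [-K] and [K] lists all such points. *)
Lemma cone_finite W n : exists s : seq 'rV[int]_N,
  uniq s /\ forall a, a \in s <-> in_cone R W (a, n%:Z).
Proof.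
pose K := (n * \sum_(i < size W) \sum_(j < N) `|(W`_i)%R ord0 j|)%N.
pose g (M : 'rV['I_(K + K).+1]_N) : 'rV[int]_N := \row_j ((M 0 j)%:Z - K%:Z).
exists [seq a <- undup (codom g) | `[< in_cone R W (a, n%:Z) >]].
split=> [|a]; first by rewrite filter_uniq ?undup_uniq.
rewrite mem_filter mem_undup; split=> [/andP[/asboolP]//|Ca].
apply/andP; split; first exact/asboolP.
case: Ca => l [l0 [/= e s]].
have bnd j : `|a 0 j| <= K%:Z.
  rewrite -(ler_int R) intr_norm.
  have -> : (a 0 j)%:~R = \sum_i l i * (W`_i 0 j)%:~R :> R.
    have /rowP/(_ j) := e; rewrite mxE => ->; rewrite summxE.
    by apply: eq_bigr => i _; rewrite !mxE.
  apply: le_trans (ler_norm_sum _ _ _) _.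
  rewrite /K -pmulrn natrM.
  have -> : (n%:R : R) = \sum_i l i by rewrite -s pmulrn.
  rewrite mulr_suml; apply: ler_sum => i _.
  rewrite normrM (ger0_norm (l0 i)); apply: ler_wpM2l => //.
  rewrite -intr_norm -natr_absz ler_nat.
  rewrite (bigD1 i) //= (bigD1 j) //=; exact: leq_trans (leq_addr _ _) (leq_addr _ _).
apply/codomP; exists (\row_(j < N) inord (absz (a 0 j + K%:Z))).
have shift (z : int) (k : nat) : `|z| <= k%:Z ->
    (absz (z + k%:Z)%R < (k + k).+1)%N /\ z = (absz (z + k%:Z))%:Z - k%:Z by lia.
by apply/rowP => j; have [h1 h2] := shift _ _ (bnd j); rewrite !mxE inordK.
Qed.

End Homogenization.

(** * Dimension, rank and the size of bases *)

Section Rank.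
Variables (F : fieldType) (N : nat).

(** The row space is the sum of the difference space, where the last coordinate vanishes, and of the
    line through [r0], where it does not. *)
Lemma rank_homogenize n (u : 'I_n.+1 -> 'rV[F]_N) :
  \rank (\matrix_i row_mx (u i) (const_mx 1 : 'rV_1)) =
  (\rank (\matrix_i (u i - u ord0))).+1.
Proof.
set H := \matrix_i row_mx _ _; set D := \matrix_i (_ - _).
pose D' : 'M_(n.+1, N + 1) := row_mx D 0.
pose r0 : 'rV_(N + 1) := row_mx (u ord0) (const_mx 1).
have rowD i : row i D' = row i H - r0.
  rewrite row_row_mx !rowK row0 /r0 opp_row_mx add_row_mx; congr row_mx.
  by apply/rowP => k; rewrite !mxE subrr.
have HE : (H :=: D' + r0)%MS.
  apply/eqmxP/andP; split.
    apply/row_subP => i; rewrite -[row i H](subrK r0) -rowD.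
    by rewrite addmx_sub_adds ?row_sub.
  have r0H : (r0 <= H)%MS by rewrite (_ : r0 = row ord0 H) ?row_sub // rowK.
  rewrite addsmx_sub r0H andbT; apply/row_subP => i.
  by rewrite rowD addmx_sub ?row_sub // eqmx_opp.
have cap : (D' :&: r0)%MS = 0.
  apply/eqP/rowV0P => v; rewrite sub_capmx => /andP[/submxP[A eA] /submxP[b eb]].
  have : v 0 (rshift N 0) = 0 by rewrite eA mul_mx_row mulmx0 row_mxEr mxE.
  rewrite {1}eb mxE big_ord1 row_mxEr mxE mulr1 => b0.
  by rewrite eb [b]mx11_scalar b0 raddf0 mul0mx.
rewrite HE (mxrank_disjoint_sum cap) -[RHS]addn1; congr addn.
  exact: rank_row_mx0.
rewrite rank_rV (_ : r0 != 0) //; apply/eqP => /rowP/(_ (rshift N 0)).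
by rewrite row_mxEr !mxE => /eqP; rewrite oner_eq0.
Qed.

End Rank.

Section BasisCard.
Variables (R : realFieldType) (n : nat) (I : finType) (w : I -> 'rV[R]_n).

Lemma cmb_enum_val (B : {set I}) l : supp B l ->
  cmb w l = \sum_(k < #|B|) l (enum_val k) *: w (enum_val k).
Proof.
move=> sl; rewrite -(big_enum_val (A := mem B) (fun i => l i *: w i)) /cmb.
rewrite [RHS]big_mkcond; apply: eq_bigr => i _.
by case: ifPn => // /sl->; rewrite scale0r.
Qed.

Lemma supp_ext (B : {set I}) (v : 'I_#|B| -> R) :
  exists2 l, supp B l & forall k, l (enum_val k) = v k.
Proof.
exists (fun i => \sum_(k < #|B| | enum_val k == i) v k) => [i iB|k].
  by rewrite big1 // => k /eqP e; rewrite -e enum_valP in iB.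
rewrite (bigD1 k) //= big1 ?addr0 // => k' /andP[/eqP/enum_val_inj->].
by rewrite eqxx.
Qed.

Lemma basis_free (B : {set I}) : basis w B ->
  row_free (\matrix_(k < #|B|) w (enum_val k)).
Proof.
case=> iB _; rewrite -kermx_eq0; apply/rowV0P => v /sub_kermxP e.
have [l sl lE] := supp_ext (fun k => v 0 k).
apply/rowP => k; rewrite mxE -lE; apply: iB => //.
rewrite (cmb_enum_val sl) -[RHS]e mulmx_sum_row; apply: eq_bigr => i _.
by rewrite rowK lE.
Qed.

(** Translates bases as index sets into matrix rank, so that all of them have the same size. *)
Lemma card_basis (B : {set I}) p (M : 'M_(p, n)) :
  (forall i, (w i <= M)%MS) -> (forall k, exists l, row k M = cmb w l) ->
  basis w B -> #|B| = \rank M.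
Proof.
move=> wM Mw bB; rewrite -(eqP (basis_free bB)); apply: eqmx_rank; apply/andP; split.
  by apply/row_subP => k; rewrite rowK.
apply/row_subP => k; have [l ->] := Mw k.
have [a sa <-] := basis_span l bB; rewrite (cmb_enum_val sa).
apply: summx_sub => i _; apply: scalemx_sub.
rewrite (_ : w _ = row i (\matrix_(k < #|B|) w (enum_val k))) ?row_sub //.
by rewrite rowK.
Qed.

End BasisCard.

Section Simplices.
Variables (R : realType) (N : nat) (V : seq 'rV[int]_N).
Hypothesis V0 : V != [::].
Notation d := (dimP R V).
Notation hom := (@hom R N).

Let MV : 'M[R]_(size V, N + 1) := \matrix_(i < size V) hom (pt V`_i).

Lemma rank_hom_family n (f : 'I_n.+1 -> 'rV[int]_N) :
  \rank (\matrix_i hom (pt (f i))) =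
  (\rank (\matrix_i (emb R (f i) - emb R (f ord0)))).+1.
Proof. exact: (@rank_homogenize _ _ _ (fun i => emb R (f i))). Qed.

Lemma rank_vertices : \rank MV = d.+1.
Proof.
rewrite /MV /dimP; case: V V0 => // v s _.
exact: (@rank_hom_family (size s) (fun i => (v :: s)`_i)).
Qed.

Lemma cone_sub_vertices x : in_cone R V x -> (hom x <= MV)%MS.
Proof.
move=> /in_coneP[l _ <-]; apply: summx_sub => i _; apply: scalemx_sub.
by rewrite (_ : hom _ = row i MV) ?row_sub // rowK.
Qed.

Lemma cmb_mulmx n (g : 'I_n -> 'rV[R]_(N + 1)) (r : 'rV[R]_n) :
  cmb g (fun i => r 0 i) = r *m \matrix_i g i.
Proof. by rewrite mulmx_sum_row; apply: eq_bigr => i _; rewrite rowK. Qed.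

(** The homogenized vertices of [f] are [d + 1] independent rows in the row space of [MV], whose
    rank is also [d + 1]. *)
Lemma simplex_basis (f : 'I_d.+1 -> 'rV[int]_N) :
  (forall i, in_cone R V (pt (f i))) ->
  \rank (\matrix_i (emb R (f i) - emb R (f ord0))) = d ->
  (forall r, cmb (fun i => hom (pt (f i))) r = 0 -> forall i, r i = 0) /\
  (forall x, in_cone R V x ->
     exists r, cmb (fun i => hom (pt (f i))) r = hom x).
Proof.
move=> Cf rk; have rkf := rank_hom_family f; rewrite rk in rkf.
set Mf := (\matrix_i hom (pt (f i))) in rkf.
have Mfree : row_free Mf by apply/eqP.
have sub : (Mf <= MV)%MS.
  by apply/row_subP => i; rewrite rowK; exact: cone_sub_vertices.
have sub' : (MV <= Mf)%MS.
  by rewrite -(geq_leqif (mxrank_leqif_sup sub)) rank_vertices rkf.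
split=> [r e i|x /cone_sub_vertices xV].
  have : (\row_i r i) *m Mf = 0 *m Mf.
    rewrite mul0mx -cmb_mulmx -[RHS]e; apply: eq_cmb => k; by rewrite mxE.
  by move/(row_free_inj Mfree)/rowP/(_ i); rewrite !mxE.
have /submxP[r e] := submx_trans xV sub'.
by exists (fun i => r 0 i); rewrite cmb_mulmx.
Qed.

Lemma card_cone_basis (I : finType) (v : I -> 'rV[int]_N) (B : {set I}) :
  (forall i, in_cone R V (pt (v i))) ->
  (forall a, a \in V -> exists i, v i = a) ->
  basis (fun i => hom (pt (v i))) B -> #|B| = d.+1.
Proof.
move=> Cv Vv bB; rewrite -rank_vertices.
apply: (card_basis _ _ bB) => [i|k]; first exact: cone_sub_vertices.
have [|i vi] := Vv V`_k; first exact: mem_nth.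
exists (fun j => (j == i)%:R).
by rewrite rowK (cmb_delta (fun i => hom (pt (v i)))) vi.
Qed.

End Simplices.

(** Integer part for a half-open cell: the floor when the facet is included ([b] true), the ceiling
    minus one when it is excluded. *)
Lemma nat_unit_shift (R : realType) (z : R) (b : bool) :
  0 < z \/ (z = 0 /\ b) ->
  exists k : nat, if b then 0 <= z - k%:R < 1 else 0 < z - k%:R <= 1.
Proof.
case: b => h.
  have z0 : 0 <= z by case: h => [/ltW|[->]].
  exists (Num.truncn z); have /andP[h1 h2] := truncn_itv z0.
  by rewrite -natr1 in h2; lra.
have z0 : 0 < z by case: h => // [[]].
have : (0 < `|Num.ceil z|)%N.
  by rewrite absz_gt0 gt_eqF // -(ltr_int R); exact: lt_le_trans z0 (ceil_ge _).
have cz : (`|Num.ceil z|%N)%:R = (Num.ceil z)%:~R :> R.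
  by rewrite natr_absz ger0_norm // -(ler_int R) ltW // (lt_le_trans z0 (ceil_ge _)).
case: `|Num.ceil z|%N cz => // k cz _; exists k.
have := ceil_ge z; have := ceilB1_lt z; rewrite intrB -cz -natr1.
lra.
Qed.

Lemma nat_unit_shift_uniq (R : realType) (u u' : R) (k k' : nat) (b : bool) :
  (if b then 0 <= u < 1 else 0 < u <= 1) ->
  (if b then 0 <= u' < 1 else 0 < u' <= 1) ->
  u + k%:R = u' + k'%:R -> k = k'.
Proof.
move=> h h' e.
have bd : -1 < (k%:R : R) - k'%:R < 1 by case: b h h' => *; lra.
by case: (ltngtP k k') => //; rewrite -(ler_nat R) -natr1 => lt; exfalso; lra.
Qed.

(** * Half-open decomposition of the cone *)

Section HalfOpenDecomposition.
Variables (R : realType) (N : nat) (V : seq 'rV[int]_N).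
Notation d := (dimP R V).
Notation hom := (@hom R N).
Variables (I : finType) (i0 : I) (v : I -> 'rV[int]_N).
Notation w := (fun i => hom (pt (v i))).
Hypothesis Cv : forall i, in_cone R V (pt (v i)).
Hypothesis Vv : forall a, a \in V -> exists i, v i = a.
Hypothesis basis_card : forall B, basis w B -> #|B| = d.+1.
Variable c : I -> R.
Hypothesis c_ge0 : forall i, 0 <= c i.
Hypothesis c_gen : forall B j a, basis w B -> j \notin B -> supp B a ->
  cmb w a = w j -> \sum_i a i * c i != c j.
Variable s : I -> R.
Hypothesis s_ge0 : forall i, 0 <= s i.
Hypothesis s_gt0 : 0 < \sum_i s i.
Notation q := (cmb w s).
Hypothesis q_gen : forall B m, basis w B -> supp B m -> cmb w m = q ->
  forall i, i \in B -> m i != 0.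

Definition vert (B : {set I}) (k : 'I_d.+1) : I := nth i0 (enum B) k.

Lemma vert_ext (T : nmodType) (B : {set I}) (k : 'I_d.+1 -> T) : #|B| = d.+1 ->
  exists K : I -> T, (forall i, i \notin B -> K i = 0) /\
                       (forall j, K (vert B j) = k j).
Proof.
move=> cB; exists (fun i => if i \in B then k (inord (index i (enum B))) else 0).
split=> [i /negbTE->//|j].
have jB : (j < size (enum B))%N by rewrite -cardE cB.
have -> : vert B j \in B by rewrite -mem_enum mem_nth.
by rewrite index_uniq ?enum_uniq // inord_val.
Qed.

Lemma sum_vert (T : nmodType) (B : {set I}) (F : I -> T) : #|B| = d.+1 ->
  \sum_(j < d.+1) F (vert B j) = \sum_(i in B) F i.
Proof.
move=> cB; have sz : size (enum B) = d.+1 by rewrite -cardE.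
by rewrite -[RHS]big_enum /= (big_nth i0) sz big_mkord.
Qed.

Definition nsum (K : I -> nat) : lpt N := \sum_i pt (v i) *+ K i.

Lemma hom_nsum K : hom (nsum K) = cmb w (fun i => (K i)%:R).
Proof. by rewrite hom_sum; apply: eq_bigr => i _; rewrite homMn. Qed.

Lemma nsum_vert (B : {set I}) (K : I -> nat) : #|B| = d.+1 ->
  (forall i, i \notin B -> K i = 0%N) ->
  \sum_j pt (v (vert B j)) *+ K (vert B j) = nsum K.
Proof.
move=> cB K0; rewrite (sum_vert (fun i => pt (v i) *+ K i)) // /nsum.
by rewrite big_mkcond; apply: eq_bigr => i _; case: ifPn => // /K0->.
Qed.

(** The half-open fundamental parallelepiped of a cell, whose vertices are listed by [g]. A
    coordinate may be 0 where the direction [q] points inwards, and may be 1 elsewhere. *)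
Definition reduced (p : lpt N) (g : 'I_d.+1 -> 'rV[int]_N) := exists B l m,
  [/\ half_open w c q (hom p) B l m, g = v \o vert B
    & forall i, i \in B -> if 0 < m i then 0 <= l i < 1 else 0 < l i <= 1].

Lemma half_open_ge0 x B l m i : half_open w c q x B l m -> 0 <= l i.
Proof.
case=> _ _ sl _ _ _ pos; case: (boolP (i \in B)) => [/pos|/sl->//].
by case=> [/ltW|[->]].
Qed.

Lemma half_open_cone x B l m : half_open w c q (hom x) B l m -> in_cone R V x.
Proof.
move=> h; apply: (@cone_cmb _ _ _ _ v l) => //; last by case: h.
by move=> i; exact: half_open_ge0 h.
Qed.

Lemma reduced_cone p g : reduced p g -> in_cone R V p.
Proof. by case=> B [l [m [/half_open_cone]]]. Qed.

Lemma reduced_vertex p g k : reduced p g -> in_cone R V (pt (g k)).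
Proof. by case=> B [l [m [_ ->]]] _; exact: Cv. Qed.

Lemma reduced_inj p g (k k' : 'I_d.+1 -> nat) : reduced p g ->
  \sum_j pt (g j) *+ k j = \sum_j pt (g j) *+ k' j -> k =1 k'.
Proof.
case=> B [l [m [[bB _ _ _ _ _ _] -> _]]] e j; have cB := basis_card bB.
have [K [K0 KE]] := vert_ext k cB; have [K' [K'0 K'E]] := vert_ext k' cB.
have E : nsum K = nsum K'.
  rewrite -(nsum_vert cB K0) -(nsum_vert cB K'0); move: e => /= e.
  by under eq_bigr do rewrite KE; rewrite e; under eq_bigr do rewrite -K'E.
rewrite -KE -K'E; apply/eqP; rewrite -(eqr_nat R); apply/eqP.
have := congr1 hom E; rewrite !hom_nsum.
move=> E'; apply: (coord_uniq bB.1 _ _ E') => i iB; by rewrite ?K0 ?K'0.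
Qed.

(** All [d + 1] coordinates are at most 1, and one is strictly smaller: [q] has positive degree,
    hence a positive coordinate [m i] in [B]. *)
Lemma reduced_deg p g : reduced p g -> p.2 <= d%:Z.
Proof.
case=> B [l [m [[bB _ sl el sm em _] _ un]]]; have cB := basis_card bB.
rewrite -ltzD1 -(ltr_int R) -hdeg_hom -el hdeg_cmb.
have sumB r : supp B r -> \sum_i r i = \sum_(i in B) r i :> R.
  move=> sr; rewrite [RHS]big_mkcond; apply: eq_bigr => i _.
  by case: ifPn => // /sr.
have [i iB mi] : exists2 i, i \in B & 0 < m i.
  apply: contrapT => no; have : \sum_i m i <= 0.
    rewrite sumB //; apply: sumr_le0 => i iB.
    by rewrite leNgt; apply/negP => mi; apply: no; exists i.
  by rewrite -(hdeg_cmb v) em hdeg_cmb leNgt s_gt0.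
have -> : (d%:Z + 1)%:~R = \sum_(k in B) (1 : R).
  by rewrite sumr_const cB intrD -pmulrn natr1.
rewrite sumB // (bigD1 i) //= [ltRHS](bigD1 i) //=; apply: ltr_leD.
  by have := un i iB; rewrite mi => /andP[].
apply: ler_sum => k /andP[kB _]; have := un k kB.
by case: ifP => _ /andP[]; [move=> _ /ltW|].
Qed.

(** Strip the integer parts from the coordinates of [x] in its half-open cell; the remainder stays
    in that cell. *)
Lemma reduced_exists x : in_cone R V x -> exists p g (k : 'I_d.+1 -> nat),
  reduced p g /\ x = p + \sum_j pt (g j) *+ k j.
Proof.
move=> Cx.
have [l0 l00 el0] := cone_cover Vv Cx.
have [B [l [m h]]] := half_open_exists c_ge0 c_gen q_gen s_ge0 erefl l00 el0.
have [bB dB sl el sm em pos] := h; have cB := basis_card bB.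
have /choice[K KP] : forall i, exists k : nat, if i \in B then
    if 0 < m i then 0 <= l i - k%:R < 1 else 0 < l i - k%:R <= 1 else k == 0%N.
  move=> i; case: (boolP (i \in B)) => iB; last by exists 0%N.
  by have [k hk] := @nat_unit_shift R (l i) (0 < m i) (pos i iB); exists k.
have K0 i : i \notin B -> K i = 0%N by move=> /negbTE iB; have := KP i; rewrite iB => /eqP.
exists (x - nsum K), (v \o vert B), (fun j => K (vert B j)); split; last first.
  by rewrite (nsum_vert cB K0) subrK.
exists B, (fun i => l i + (-1) * (K i)%:R), m; split=> //; last first.
  by move=> i iB; have := KP i; rewrite iB mulN1r.
split=> //.
- by move=> i iB; rewrite sl // K0 // mulr0 addr0.
- by rewrite cmb_lin el scaleN1r -hom_nsum homD homN.
- move=> i iB; have := KP i; rewrite iB mulN1r.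
  case: ifP => mi /andP[h1 h2]; last by left.
  by move: h1; rewrite le_eqVlt => /orP[/eqP<-|]; [right|left].
Qed.

Lemma half_open_shift p B l m K : half_open w c q (hom p) B l m ->
  (forall i, i \notin B -> K i = 0%N) ->
  half_open w c q (hom (p + nsum K)) B (fun i => l i + 1 * (K i)%:R) m.
Proof.
case=> bB dB sl el sm em pos K0; split=> //.
- by move=> i iB; rewrite sl // K0 // mulr0 addr0.
- by rewrite cmb_lin el scale1r -hom_nsum homD.
- move=> i iB; rewrite mul1r; case: (pos i iB) => [l0|[-> m0]].
    by left; have := ler0n R (K i); lra.
  by case: (K i) => [|k]; [right; rewrite addr0|left; rewrite add0r ltr0n].
Qed.

(** Adding vertices does not leave the half-open cell, so both expressions live in the one cell of
    their common value; there the unit intervals fix the integer parts. *)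
Lemma reduced_unique p g k p' g' k' : reduced p g -> reduced p' g' ->
  p + \sum_j pt (g j) *+ k j = p' + \sum_j pt (g' j) *+ k' j ->
  p = p' /\ g = g'.
Proof.
case=> B [l [m [h -> un]]] [B' [l' [m' [h' -> un']]]].
have [bB _ sl el sm em _] := h; have [bB' _ sl' el' sm' em' _] := h'.
have cB := basis_card bB; have cB' := basis_card bB'.
have [K [K0 KE]] := vert_ext k cB; have [K' [K'0 K'E]] := vert_ext k' cB'.
under eq_bigr do rewrite -KE.
under [X in _ = _ + X]eq_bigr do rewrite -K'E.
rewrite (nsum_vert cB K0) (nsum_vert cB' K'0) => E.
have hx := half_open_shift h K0; have hx' := half_open_shift h' K'0.
rewrite -E in hx'.
have BB := half_open_unique hx hx'; subst B'.
have mE := coord_uniq bB.1 sm sm' (etrans em (esym em')).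
case: hx hx' => _ _ sx ex _ _ _ [_ _ sx' ex' _ _ _].
have lE := coord_uniq bB.1 sx sx' (etrans ex (esym ex')).
have KK i : K i = K' i.
  case: (boolP (i \in B)) => iB; last by rewrite K0 ?K'0.
  have := un' i iB; rewrite -mE => hb'; apply: nat_unit_shift_uniq (un i iB) hb' _.
  by have := lE i; rewrite !mul1r.
split=> //; have : nsum K = nsum K' by apply: eq_bigr => i _; rewrite KK.
by move=> EK; apply: (addIr (nsum K)); rewrite E EK.
Qed.

(** With [q] interior to the cell [S] all facets are included, and the half-open box is the usual
    one. *)
Lemma reduced_box S (r : I -> R) x : basis w S -> dualf w c S ->
  (forall i, i \in S -> 0 < s i) -> supp S s ->
  supp S r -> (forall i, 0 <= r i < 1) -> cmb w r = hom x ->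
  reduced x (v \o vert S).
Proof.
move=> bS dS sS ss sr r01 er; exists S, r, s; split=> //; last first.
  by move=> i iS; rewrite sS.
split=> // i iS; have /andP[] := r01 i; rewrite le_eqVlt => /orP[/eqP<-|]; last by left.
by right; rewrite sS.
Qed.

End HalfOpenDecomposition.

Section Decomposition.
Variables (R : realType) (N : nat) (V : seq 'rV[int]_N).
Hypothesis V0 : V != [::].
Notation d := (dimP R V).

(* Stanley's monotonicity enters through the last clause: the half-open
   decomposition is built from a triangulation in which [f] is a cell, with the
   perturbation direction interior to [f], so that the box of [f] survives. *)
Lemma half_open_decomposition (f : 'I_d.+1 -> 'rV[int]_N) :
  (forall i, in_cone R V (pt (f i))) ->
  \rank (\matrix_i (emb R (f i) - emb R (f ord0))) = d ->
  exists red : lpt N -> ('I_d.+1 -> 'rV[int]_N) -> Prop,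
  [/\ forall p g, red p g -> [/\ in_cone R V p, p.2 <= d%:Z,
        forall i, in_cone R V (pt (g i))
      & forall k k' : 'I_d.+1 -> nat,
        \sum_j pt (g j) *+ k j = \sum_j pt (g j) *+ k' j -> k =1 k'],
      forall x, in_cone R V x -> exists p g (k : 'I_d.+1 -> nat),
        red p g /\ x = p + \sum_j pt (g j) *+ k j,
      forall p g k p' g' k', red p g -> red p' g' ->
        p + \sum_j pt (g j) *+ k j = p' + \sum_j pt (g' j) *+ k' j ->
        p = p' /\ g = g'
    & forall x, in_box_simplex R f x -> exists g, red x g].
Proof.
move=> Cf rk.
(* A disjoint sum of indices tolerates a vertex of [f] that also occurs in [V]; the left summand is
   the cell [S]. *)
pose I : finType := ('I_d.+1 + 'I_(size V))%type.
pose v (i : I) := match i with inl i => f i | inr j => V`_j end.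
pose w i := hom R (pt (v i)).
have Cv i : in_cone R V (pt (v i)).
  by case: i => i //=; apply: cone_mem; exact: mem_nth.
have Vv a : a \in V -> exists i, v i = a.
  by move=> /(nthP 0)[i iV <-]; exists (inr (Ordinal iV)).
have bc B : basis w B -> #|B| = d.+1 by exact: card_cone_basis.
pose S : {set I} := [set i : I | if i is inl _ then true else false].
have [fI fS] := simplex_basis V0 Cf rk.
have cmbS (r : I -> R) : supp S r ->
    cmb w r = cmb (fun i => hom R (pt (f i))) (fun i => r (inl i)).
  move=> sr; rewrite /cmb big_sumType /= [X in _ + X]big1 ?addr0 // => i _.
  by rewrite sr ?inE // scale0r.
pose ext (r : 'I_d.+1 -> R) (i : I) := if i is inl i then r i else 0.
have sext r : supp S (ext r) by case=> i; rewrite inE.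
have bS : basis w S.
  split=> [l sl|].
    by rewrite cmbS // => /fI h [i|i]; [exact: h|rewrite sl ?inE].
  have /choice[A AP] : forall j, exists r, cmb (fun i => hom R (pt (f i))) r = w j.
    by move=> j; exact: fS.
  by exists (fun j => ext (A j)) => j; split=> //; rewrite cmbS //= -AP.
have [s [s_pos ss q_gen]] := generic_direction bS.
have [c [c0 dS c_gen]] := generic_cost bS.
have s0 i : 0 <= s i.
  by case: (boolP (i \in S)) => [/s_pos/ltW//|/ss->].
have s_gt0 : 0 < \sum_i s i.
  rewrite (bigD1 (inl ord0)) //=; apply: ltr_pwDl; last exact: sumr_ge0.
  by apply: s_pos; rewrite inE.
pose i0 : I := inl ord0.
exists (reduced i0 v c s); split.
- move=> p g h; split; [exact: reduced_cone h|exact: reduced_deg h| |].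
    by move=> i; exact: reduced_vertex h.
  by move=> k k'; exact: reduced_inj h.
- by move=> x; exact: reduced_exists.
- by move=> p g k p' g' k'; exact: reduced_unique.
move=> x [r [r01 [e1 e2]]].
exists (v \o vert i0 S); apply: (@reduced_box _ _ _ _ i0 v c s S (ext r)) => //.
  by case=> i //=; rewrite lexx ltr01.
by rewrite cmbS //=; apply/cmb_homP.
Qed.

End Decomposition.

(** * Ehrhart series *)

Lemma sum_pt N (I : finType) (g : I -> 'rV[int]_N) (k : I -> nat) :
  \sum_j pt (g j) *+ k j = (\sum_j g j *+ k j, (\sum_j k j)%N%:Z).
Proof.
have ptMn a n : pt a *+ n = (a *+ n, n%:Z) :> lpt N.
  elim: n => [|n IH]; first by rewrite !mulr0n.
  by rewrite mulrS IH mulrS; congr pair; rewrite -PoszD.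
elim/big_rec3: _ => // j a b x _ ->.
by rewrite ptMn PoszD.
Qed.

Section Counting.
Variables (R : realType) (N : nat) (V : seq 'rV[int]_N).
Hypothesis V0 : V != [::].
Notation d := (dimP R V).
Variable red : lpt N -> ('I_d.+1 -> 'rV[int]_N) -> Prop.
Hypothesis red_spec : forall p g, red p g -> [/\ in_cone R V p, p.2 <= d%:Z,
        forall i, in_cone R V (pt (g i))
      & forall k k' : 'I_d.+1 -> nat,
        \sum_j pt (g j) *+ k j = \sum_j pt (g j) *+ k' j -> k =1 k'].
Hypothesis red_exists : forall x, in_cone R V x ->
  exists p g (k : 'I_d.+1 -> nat), red p g /\ x = p + \sum_j pt (g j) *+ k j.
Hypothesis red_unique : forall p g k p' g' k', red p g -> red p' g' ->
  p + \sum_j pt (g j) *+ k j = p' + \sum_j pt (g' j) *+ k' j ->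
  p = p' /\ g = g'.
Variable pts : nat -> seq 'rV[int]_N.
Hypothesis pts_uniq : forall n, uniq (pts n).
Hypothesis ptsP : forall n a, a \in pts n <-> in_cone R V (a, n%:Z).

Definition fiber p x := `[< exists g (k : 'I_d.+1 -> nat),
  red p g /\ x = p + \sum_j pt (g j) *+ k j >].

(** Stars and bars: points of degree [n] over the box point correspond to [d + 1] multiplicities
    summing to [n - i]. *)
Lemma fiber_count b i g n : red (b, i%:Z) g ->
  count (fun a => fiber (b, i%:Z) (a, n%:Z)) (pts n) =
  (if i <= n then 'C(n - i + d, d) else 0)%N.
Proof.
move=> rg; have [Cb _ Cg ginj] := red_spec rg.
case: ifPn => [le|]; last first.
  rewrite -ltnNge => lt; apply/eqP; rewrite -leqn0 leqNgt -has_count.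
  apply/hasPn => a _; apply/asboolPn => -[g' [k [_]]].
  by rewrite sum_pt => /(congr1 snd) /=; lia.
set e := (n - i)%N.
pose T := [set t : d.+1.-tuple 'I_e.+1 | \sum_(i <- t) i == e]%N.
pose phi (t : d.+1.-tuple 'I_e.+1) := b + \sum_j g j *+ tnth t j.
rewrite addnC -card_ord_partitions -/T cardE -size_filter -(size_map phi).
have memT (t : d.+1.-tuple 'I_e.+1) : t \in T -> (\sum_j tnth t j)%N = e.
  by rewrite inE big_tuple => /eqP.
have phiE t : t \in T ->
    (phi t, n%:Z) = (b, i%:Z) + \sum_j pt (g j) *+ tnth t j.
  by move=> tT; rewrite sum_pt memT //; congr pair; rewrite -PoszD subnKC.
apply/perm_size/uniq_perm; first by rewrite filter_uniq.
  rewrite map_inj_in_uniq ?enum_uniq // => t t'; rewrite !mem_enum => tT tT' E.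
  apply: eq_from_tnth => j; apply: val_inj; apply: (ginj (fun j => tnth t j)
    (fun j => tnth t' j)); apply: (addrI (b, i%:Z)).
  by rewrite -!phiE // E.
move=> a; rewrite mem_filter; apply/andP/mapP => [[/asboolP[g' [k [rg' E]]] _]|].
  (* Uniqueness with zero multiplicities shows that the box point determines its cell. *)
  have [_ gg] : (b, i%:Z) = (b, i%:Z) /\ g' = g.
    by apply: (red_unique (k := fun=> 0%N) (k' := fun=> 0%N) rg' rg); rewrite !big1.
  rewrite {}gg {rg'} in E.
  have sk : (\sum_j k j = e)%N.
    by move: E; rewrite sum_pt => /(congr1 snd) /=; rewrite /e; lia.
  have ke j : (k j < e.+1)%N by rewrite ltnS -sk (bigD1 j) //= leq_addr.
  pose t := [tuple (inord (k j) : 'I_e.+1) | j < d.+1].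
  have tE j : tnth t j = k j :> nat by rewrite tnth_mktuple inordK.
  exists t.
    rewrite mem_enum inE big_tuple; apply/eqP; apply: etrans sk.
    by apply: eq_bigr => j _; exact: tE.
  move: E; rewrite sum_pt => /(congr1 fst) /= ->; rewrite /phi; congr (_ + _).
  by apply: eq_bigr => j _; rewrite tE.
case=> t; rewrite mem_enum => tT ->; split.
  by apply/asboolP; exists g, (fun j => nat_of_ord (tnth t j)); split=> //; exact: phiE.
apply/ptsP; rewrite phiE //; apply: coneD => //; apply: cone_sum => j _.
exact: coneMn.
Qed.

Definition redpts i := [seq a <- pts i | `[< exists g, red (a, i%:Z) g >]].

(** Double counting: each lattice point of the cone lies over exactly one reduced point, whose
    degree is at most [d]. *)
Lemma count_fibers n : size (pts n) =
  (\sum_(i < d.+1) \sum_(b <- redpts i)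
     count (fun a => fiber (b, i%:Z) (a, n%:Z)) (pts n))%N.
Proof.
have one a : a \in pts n ->
  (\sum_(i < d.+1) \sum_(b <- redpts i) fiber (b, i%:Z) (a, n%:Z) = 1)%N.
  move=> /ptsP Ca; have [p [g [k [rg E]]]] := red_exists Ca.
  have [Cp dp _ _] := red_spec rg.
  have uni b i : fiber (b, i%:Z) (a, n%:Z) -> (b, i%:Z) = p.
    move=> /asboolP[g' [k' [rg' E']]].
    by rewrite E in E'; have [] := red_unique rg rg' E'.
  have p0 := cone_deg_ge0 Cp.
  have [i ip] : exists i : nat, p.2 = i%:Z by exists `|p.2|%N; lia.
  have id : (i < d.+1)%N by lia.
  have pE : p = (p.1, i%:Z) by case: (p) ip => ? ? /= ->.
  rewrite (bigD1 (Ordinal id)) //= [X in (_ + X)%N]big1 ?addn0; last first.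
    move=> j ji; rewrite big1_seq // => b _; apply/eqP; rewrite eqb0.
    apply: contra ji => /uni/(congr1 snd) /=; rewrite ip => -[ji].
    by apply/eqP/val_inj.
  have pR : p.1 \in redpts i.
    rewrite mem_filter; apply/andP; split; last by apply/ptsP; rewrite -pE.
    by apply/asboolP; exists g; rewrite -pE.
  rewrite (bigD1_seq p.1) //= ?filter_uniq //.
  rewrite [X in (_ + X)%N]big1 ?addn0 => [|b bp]; last first.
    apply/eqP; rewrite eqb0; apply: contra bp => /uni/(congr1 fst) /= ->.
    by rewrite eqxx.
  have -> // : fiber (p.1, i%:Z) (a, n%:Z).
  by apply/asboolP; exists g, k; rewrite -pE.
rewrite -sum1_size; transitivity (\sum_(a <- pts n)
    \sum_(i < d.+1) \sum_(b <- redpts i) fiber (b, i%:Z) (a, n%:Z))%N.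
  by apply: eq_big_seq => a /one.
rewrite exchange_big /=; apply: eq_bigr => i _; rewrite exchange_big /=.
apply: eq_bigr => b _; rewrite -sum1_count [RHS]big_mkcond /=.
by apply: eq_bigr => a _; case: fiber.
Qed.

Lemma is_delta_redpts : is_delta R V (fun i => (size (redpts i))%:Z).
Proof.
split=> [i di|n].
  case E: (redpts i) => [//|b s]; have : b \in redpts i by rewrite E mem_head.
  rewrite mem_filter => /andP[/asboolP[g /red_spec[_ /= le _ _]] _]; lia.
exists (size (pts n)); split.
  exists (pts n); split=> //; split=> // a; rewrite in_poly_dil //; exact: ptsP.
rewrite count_fibers (big_morph Posz PoszD (erefl 0)) [RHS]big_mkcond /=.
apply: eq_bigr => i _.
have -> : (\sum_(b <- redpts i) count (fun a => fiber (b, i%:Z) (a, n%:Z)) (pts n))%N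
    = (\sum_(b <- redpts i) if i <= n then 'C(n - i + d, d) else 0)%N.
  apply: eq_big_seq => b; rewrite mem_filter => /andP[/asboolP[g rg] _].
  exact: fiber_count rg.
rewrite big_const_seq count_predT iter_addn_0 mulnC.
by case: ifP => _; rewrite ?muln0 // PoszM.
Qed.

End Counting.

Section EhrhartExists.
Variables (R : realType) (N : nat) (V : seq 'rV[int]_N).
Hypothesis V0 : V != [::].
Notation d := (dimP R V).

Lemma delta_of_simplex (f : 'I_d.+1 -> 'rV[int]_N) :
  (forall i, in_cone R V (pt (f i))) ->
  \rank (\matrix_i (emb R (f i) - emb R (f ord0))) = d ->
  exists2 delta, is_delta R V delta &
    forall x (n : nat), in_box_simplex R f x -> x.2 = n%:Z -> delta n != 0.
Proof.
move=> Cf rk; have [red [spec ex uni box]] := half_open_decomposition V0 Cf rk.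
have /choice[pts pP] : forall n : nat, exists s : seq 'rV[int]_N,
    uniq s /\ forall a, a \in s <-> in_cone R V (a, n%:Z).
  by move=> n; exact: cone_finite.
have pu n : uniq (pts n) by case: (pP n).
have pc n a : a \in pts n <-> in_cone R V (a, n%:Z) by case: (pP n).
exists (fun i => (size (redpts red pts i))%:Z); first exact: is_delta_redpts.
move=> x n bx xn; have [g rg] := box x bx; have [Cx _ _ _] := spec _ _ rg.
have xE : x = (x.1, n%:Z) by case: (x) xn => ? ? /= ->.
suff : x.1 \in redpts red pts n by case: redpts.
rewrite mem_filter; apply/andP; split; last by apply/pc; rewrite -xE.
by apply/asboolP; exists g; rewrite -xE.
Qed.

Lemma has_card_uniq (T : eqType) (P : T -> Prop) k k' :
  has_card P k -> has_card P k' -> k = k'.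
Proof.
move=> [s [us [<- sP]]] [s' [us' [<- s'P]]]; apply/perm_size/uniq_perm => // a.
by apply/idP/idP => [/sP/s'P|/s'P/sP].
Qed.

(** The system is triangular with unit diagonal. Hence triangulations adapted to different simplices
    all compute the same vector. *)
Lemma is_delta_uniq delta delta' : is_delta R V delta -> is_delta R V delta' ->
  delta =1 delta'.
Proof.
move=> [z h] [z' h'] n; elim/ltn_ind: n => n IH.
case: (leqP n d) => nd; last by rewrite z ?z'.
have [k [ck ek]] := h n; have [k' [ck' ek']] := h' n.
rewrite (has_card_uniq ck' ck) ek in ek'.
have n1 : (n < d.+1)%N by [].
move: ek'; rewrite (bigD1 (Ordinal n1)) //= [RHS](bigD1 (Ordinal n1)) //=.
rewrite subnn add0n binn !mulr1 => E.
have S : \sum_(i < d.+1 | (i <= n)%N && (i != Ordinal n1))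
       delta i * ('C(n - i + d, d))%:Z =
   \sum_(i < d.+1 | (i <= n)%N && (i != Ordinal n1))
       delta' i * ('C(n - i + d, d))%:Z.
  apply: eq_bigr => i /andP[le ni]; rewrite IH // ltn_neqAle le andbT.
  by apply: contra ni => /eqP ni; apply/eqP/val_inj.
by move: E; rewrite S => /addIr.
Qed.

End EhrhartExists.

(** * Empty simplices *)

Section EmptySimplices.
Variables (R : realType) (N : nat) (V : seq 'rV[int]_N).
Hypothesis V0 : V != [::].
Notation d := (dimP R V).
Notation hom := (@hom R N).

Section MinimalBasis.
Variables (I : finType) (v : I -> 'rV[int]_N).
Hypothesis v_inj : injective v.
Notation w := (fun i => hom (pt (v i))).

Definition in_hull (B : {set I}) y := exists l,
  [/\ supp B l, forall i, 0 <= l i & cmb w l = y].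

(** All generators have height one, so this is the set of given points in the simplex on [B]; its
    size is the descent measure. *)
Definition hull_pts (B : {set I}) := [set i | `[< in_hull B (w i) >]].

(* If the simplex on [B] contains the further point [v j], pivoting [j] in gives
   a strictly smaller simplex whose cone still contains [y]. *)
Lemma pivot_hull B y j : basis w B -> in_hull B y -> in_hull B (w j) ->
  j \notin B -> exists B', [/\ basis w B', in_hull B' y
    & (#|hull_pts B'| < #|hull_pts B|)%N].
Proof.
move=> bB [l [sl l0 el]] [a [sa a0 ea]] jB.
have a1 : \sum_i a i = 1 by rewrite -(hdeg_cmb v) ea hdeg_hom.
have [i0 ai0] : exists i0, 0 < a i0.
  apply: contrapT => /forallNP na; have : \sum_i a i <= 0.
    by apply: sumr_le0 => i _; rewrite leNgt; apply/negP/na.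
  by rewrite a1 ler10.
have [b [[bB' ab] bB1 sl' l'0 el']] := pivot bB sl l0 sa ea jB ai0.
have bj : (b == j) = false by apply: contraNF jB => /eqP <-.
set B' := (j |: B :\ b) in bB1 sl'.
exists B'; split=> //; first by eexists; split; [exact: sl'|exact: l'0|rewrite el'].
(* Substituting [a] for [w j] turns coordinates in [B'] into coordinates in [B], preserving
   nonnegativity. *)
pose tr (u : I -> R) i := u i + u j * (a i + (-1) * (i == j)%:R).
have trC u : cmb w (tr u) = cmb w u.
  by rewrite cmb_lin cmb_lin cmb_delta ea scaleN1r subrr scaler0 addr0.
have trS u : supp B' u -> supp B (tr u).
  move=> su i iB; rewrite /tr; case: (eqVneq i j) => [->|ij].
    by rewrite (sa j) // mulr1 add0r mulrN1 subrr.
  rewrite (sa i) // (su i); first by rewrite mulr0 addr0 mulr0 addr0.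
  by rewrite /B' !inE (negbTE ij) (negbTE iB) andbF.
have tr0 u i : (forall k, 0 <= u k) -> 0 <= tr u i.
  move=> u0; rewrite /tr; case: (eqVneq i j) => [->|ij].
    by rewrite (sa j) // mulr1 add0r mulrN1 subrr.
  by rewrite mulr0 addr0 addr_ge0 // mulr_ge0.
have deltaB k : k \in B -> supp B (fun i => (i == k)%:R : R).
  by move=> kB i; case: eqP => // -> /negP.
apply: proper_card; apply/properP; split.
  apply/subsetP => i; rewrite !inE => /asboolP[u [su u0 eu]]; apply/asboolP.
  exists (tr u); split; [exact: trS|by move=> k; exact: tr0|by rewrite trC].
(* The vertex [v b] is lost: if it lay in the new simplex, [a] would be the unit vector at [b], and
   [v j] would equal [v b]. *)
exists b; rewrite inE.
  by apply/asboolP; exists (fun i => (i == b)%:R); split;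
    [exact: deltaB|move=> i; exact: ler0n|exact: cmb_delta].
apply/asboolPn => -[u [su u0 eu]].
have trE := coord_uniq bB.1 (trS u su) (deltaB b bB')
  (etrans (trC u) (etrans eu (esym (cmb_delta w b)))).
have ub : u b = 0 by rewrite su // /B' !inE bj eqxx.
have ujab : u j * a b = 1.
  by have := trE b; rewrite /tr ub bj eqxx mulr0 addr0 add0r.
have uj : u j != 0 by apply/eqP => z; move: ujab; rewrite z mul0r => /eqP; rewrite eq_sym oner_eq0.
have ak k : k != b -> a k = 0.
  move=> kb; case: (boolP (k \in B)) => kB; last exact: sa.
  have kj : (k == j) = false by apply: contraNF jB => /eqP <-.
  have := trE k; rewrite /tr kj (negbTE kb) mulr0 addr0 => e.
  have h : 0 <= u j * a k by rewrite mulr_ge0.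
  have : u j * a k = 0 by have := u0 k; move: e h => /=; lra.
  by move=> /eqP; rewrite mulf_eq0 (negbTE uj) => /eqP.
have ab1 : a b = 1 by rewrite -a1 (bigD1 b) //= big1 ?addr0.
suff /hom_inj[/v_inj/eqP] : hom (pt (v b)) = hom (pt (v j)) by rewrite bj.
rewrite -ea /cmb (bigD1 b) //= ab1 scale1r big1 ?addr0 // => k /ak->.
by rewrite scale0r.
Qed.

(** Minimise the number of given points in the simplex among all bases whose cone contains [y]. *)
Lemma empty_basis y l : (forall i, 0 <= l i) -> cmb w l = y ->
  exists B, [/\ basis w B, in_hull B y
    & forall j, in_hull B (w j) -> j \in B].
Proof.
move=> l0 el; pose P B := `[< basis w B /\ in_hull B y >].
have [B0 [l1 [bB0 sl1 l10 el1]]] := caratheodory w l0.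
have PB0 : P B0.
  by apply/asboolP; split=> //; exists l1; split=> //; rewrite el1.
case: (arg_minnP (fun B => #|hull_pts B|) PB0) => B /asboolP[bB hB] Bmin.
exists B; split=> // j hj; apply: contrapT => /negP jB.
have [B' [bB' hB' lt]] := pivot_hull bB hB hj jB.
have /Bmin : P B' by apply/asboolP.
by rewrite leqNgt lt.
Qed.

End MinimalBasis.

Lemma empty_simplex_cover x : in_cone R V x ->
  exists f : 'I_d.+1 -> 'rV[int]_N, empty_simplex R V f /\
    exists2 r, (forall i, 0 <= r i) & cmb (fun i => hom (pt (f i))) r = hom x.
Proof.
move=> Cx; have [L [uL LP]] := cone_finite R V 1.
(* The generators are all lattice points of the polytope, so a simplex containing no further
   generator is empty. *)
pose I : finType := seq_sub L; pose v (i : I) := ssval i.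
have v_inj : injective v by exact: val_inj.
have Cv i : in_cone R V (pt (v i)) by apply/LP; exact: ssvalP.
have vP a : in_cone R V (pt a) -> exists i, v i = a.
  by move=> /LP aL; exists (SeqSub aL).
have Vv a : a \in V -> exists i, v i = a by move=> /(cone_mem R)/vP.
have [i0 _] : exists i0, v i0 = V`_0.
  by apply: Vv; apply: mem_nth; rewrite lt0n size_eq0.
have [l l0 el] := cone_cover Vv Cx.
have [B [bB [r [sr r0 er]] Bemp]] := empty_basis v_inj l0 el.
have cB : #|B| = d.+1 := card_cone_basis V0 Cv Vv bB.
pose f (k : 'I_d.+1) := v (vert i0 B k).
have cmbE u : supp B u -> cmb (fun i => hom (pt (v i))) u =
    cmb (fun k => hom (pt (f k))) (fun k => u (vert i0 B k)).
  move=> su; rewrite /cmb [RHS](sum_vert i0 (fun i => u i *: hom (pt (v i)))) //.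
  rewrite [RHS]big_mkcond; apply: eq_bigr => i _.
  by case: ifPn => // /su->; rewrite scale0r.
have extE (u : 'I_d.+1 -> R) : exists2 u', supp B u' &
    (forall k, u' (vert i0 B k) = u k) /\
    cmb (fun i => hom (pt (v i))) u' = cmb (fun k => hom (pt (f k))) u.
  have [u' [su ue]] := vert_ext i0 u cB; exists u' => //; split=> //.
  by rewrite cmbE //; exact: eq_cmb.
exists f; split; last first.
  by exists (fun k => r (vert i0 B k)) => //; rewrite -cmbE.
split; first by move=> k; apply/in_poly_cone; exact: Cv.
split.
  have := rank_hom_family R f.
  have rf : row_free (\matrix_i hom (pt (f i))).
    rewrite -kermx_eq0; apply/rowV0P => u /sub_kermxP e.
    have [u' su [ue uc]] := extE (fun k => u 0 k).
    apply/rowP => k; rewrite mxE -ue; apply: bB.1 => //.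
    by rewrite uc cmb_mulmx.
  by rewrite (eqP rf) => -[].
move=> a /in_poly_family[u u0 eu].
have [i vi] : exists i, v i = a.
  by apply: vP; apply: (@cone_cmb _ _ _ _ f u) => // k; exact: Cv.
have [u' su [ue uc]] := extE u.
have iB : i \in B.
  apply: Bemp; exists u'; split=> //; last by rewrite vi -eu.
  move=> k; case: (boolP (k \in B)) => kB; last by rewrite su.
  have kE : (index k (enum B) < d.+1)%N by rewrite -cB cardE index_mem mem_enum.
  by rewrite -(nth_index i0 (s := enum B) (x := k)) ?mem_enum // (ue (Ordinal kE)).
have iE : (index i (enum B) < d.+1)%N by rewrite -cB cardE index_mem mem_enum.
by exists (Ordinal iE); rewrite /f /vert /= nth_index ?mem_enum.
Qed.

(** Split the coordinates in a covering empty simplex into fractional and integer parts. *)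
Lemma box_decomposition x : in_cone R V x ->
  exists (f : 'I_d.+1 -> 'rV[int]_N) p (z : 'I_d.+1 -> nat),
  [/\ empty_simplex R V f, in_box_simplex R f p
    & x = p + \sum_i pt (f i) *+ z i].
Proof.
move=> /empty_simplex_cover[f [ef [r r0 er]]].
exists f, (x - \sum_i pt (f i) *+ Num.truncn (r i)), (fun i => Num.truncn (r i)).
split=> //; last by rewrite subrK.
exists (fun i => r i + (-1) * (Num.truncn (r i))%:R); split.
  by move=> i; have := truncn_itv (r0 i); rewrite -natr1; lra.
apply/cmb_homP; rewrite cmb_lin er scaleN1r homD homN hom_sum; congr (_ - _).
by apply: eq_bigr => i _; rewrite homMn.
Qed.

End EmptySimplices.

(** * The invariants *)

Lemma sum_lt_card (R : numDomainType) n (r : 'I_n.+1 -> R) :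
  (forall i, r i < 1) -> \sum_i r i < n.+1%:R.
Proof.
move=> r1; have -> : n.+1%:R = \sum_(i < n.+1) (1 : R) by rewrite sumr_const card_ord.
apply: ltr_sum => [|i _]; last exact: r1.
by apply/hasP; exists ord0; rewrite ?mem_index_enum.
Qed.

Section Invariants.
Variables (R : realType) (N : nat) (V : seq 'rV[int]_N).
Hypothesis V0 : V != [::].
Notation d := (dimP R V).
Notation C := (in_cone R V).
Implicit Types (x y p : lpt N) (s : seq 'rV[int]_N).

(** Homogeneous form of a decomposition over the [k]-th dilate; for positive [k] the degree of [x]
    determines the number of summands. *)
Definition kdecomp (k : nat) x := exists s, (forall b, b \in s -> C (b, k%:Z)) /\
  x = \sum_(b <- s) (b, k%:Z).

Lemma kdecomp0 k : kdecomp k 0.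
Proof. by exists [::]; split=> //; rewrite big_nil. Qed.

Lemma kdecompD k x y : kdecomp k x -> kdecomp k y -> kdecomp k (x + y).
Proof.
move=> [s [sC ->]] [t [tC ->]]; exists (s ++ t); rewrite big_cat; split=> // b.
by rewrite mem_cat => /orP[/sC|/tC].
Qed.

Lemma kdecomp1 k b : C (b, k%:Z) -> kdecomp k (b, k%:Z).
Proof.
move=> Cb; exists [:: b]; rewrite big_seq1; split=> // c.
by rewrite inE => /eqP->.
Qed.

Lemma kdecompMn k x n : kdecomp k x -> kdecomp k (x *+ n).
Proof.
by move=> dx; elim: n => [|n IH]; rewrite ?mulrS; [exact: kdecomp0|exact: kdecompD].
Qed.

Lemma kdecomp_sum k (I : finType) (F : I -> lpt N) :
  (forall i, kdecomp k (F i)) -> kdecomp k (\sum_i F i).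
Proof.
by move=> h; elim/big_ind: _ => //; [exact: kdecomp0|exact: kdecompD].
Qed.

Lemma sum_pair (s : seq 'rV[int]_N) (k : nat) :
  \sum_(b <- s) (b, k%:Z) = (\sum_(b <- s) b, (size s * k)%N%:Z) :> lpt N.
Proof.
elim: s => [|b s IH]; first by rewrite !big_nil.
by rewrite !big_cons IH /= mulSn PoszD.
Qed.

Lemma decomp_dilP k n a : (0 < k)%N ->
  decomp R (dil k V) n a <-> kdecomp k (a, (n * k)%N%:Z).
Proof.
move=> k0; split=> [[f [fP ->]]|[s [sC]]].
  have -> : (\sum_i f i, (n * k)%N%:Z) = \sum_i (f i, k%:Z) :> lpt N.
    rewrite [RHS]surjective_pairing (raddf_sum fst) (raddf_sum snd) /=.
    by rewrite sumr_const card_ord -mulr_natl natz -PoszM.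
  by apply: kdecomp_sum => i; apply: kdecomp1; apply/in_poly_dil.
rewrite sum_pair => -[-> /eqP]; rewrite eqn_pmul2r // => /eqP ->.
exists (fun i => s`_i); split; last by rewrite (big_nth 0) big_mkord.
by move=> i; apply/in_poly_dil => //; apply: sC; exact: mem_nth.
Qed.

Lemma decompP n a : decomp R V n a <-> kdecomp 1 (a, n%:Z).
Proof.
have <- : dil 1 V = V by rewrite /dil -[RHS]map_id; apply: eq_map => v; rewrite mulr1n.
by rewrite -{2}(muln1 n); exact: decomp_dilP.
Qed.

Lemma cone_seq s : (forall b, b \in s -> C (pt b)) ->
  C (\sum_(b <- s) b, (size s)%:Z).
Proof.
move=> sC; rewrite -(muln1 (size s)) -sum_pair big_seq_cond.
by apply: cone_sum => b; rewrite andbT => /sC.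
Qed.

Lemma kdecomp_cone k x : kdecomp k x -> C x.
Proof.
move=> [s [sC ->]]; rewrite big_seq_cond; apply: cone_sum => b.
by rewrite andbT => /sC.
Qed.

(** Cut the list of height-one points into [n] blocks of length [k]. *)
Lemma kdecomp_group k n x : kdecomp 1 x -> x.2 = (n * k)%N%:Z -> kdecomp k x.
Proof.
move=> [s [sC ->]]; rewrite sum_pair /= muln1 => -[].
elim: n s sC => [|n IH] s sC sz.
  by case: s sz {sC} => // _; rewrite big_nil; exact: kdecomp0.
have ks : (k <= size s)%N by rewrite sz mulSn leq_addr.
rewrite -(cat_take_drop k s) big_cat size_cat PoszD.
apply: (@kdecompD k (_, _) (_, _)); last first.
  apply: IH; last by rewrite size_drop sz mulSn addKn.
  by move=> b /mem_drop; exact: sC.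
have st : size (take k s) = k by rewrite size_take_min; apply/minn_idPl.
rewrite st; apply: kdecomp1; rewrite -{2}st; apply: cone_seq => b /mem_take.
exact: sC.
Qed.

Lemma kdecomp_vertices (f : 'I_d.+1 -> 'rV[int]_N) (z : 'I_d.+1 -> nat) :
  (forall i, C (pt (f i))) -> kdecomp 1 (\sum_i pt (f i) *+ z i).
Proof. by move=> Cf; apply: kdecomp_sum => i; apply: kdecompMn; exact: (@kdecomp1 1 (f i) (Cf i)). Qed.

Lemma empty_simplex_cone (f : 'I_d.+1 -> 'rV[int]_N) i :
  empty_simplex R V f -> C (pt (f i)).
Proof. by case=> Cf _; apply/in_poly_cone. Qed.

Lemma box_cone (f : 'I_d.+1 -> 'rV[int]_N) p :
  empty_simplex R V f -> in_box_simplex R f p -> C p.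
Proof.
move=> ef [r [r01 h]]; apply: (@cone_cmb _ _ _ _ f r).
- by move=> i; exact: empty_simplex_cone.
- by move=> i; case/andP: (r01 i).
- exact/cmb_homP.
Qed.

Lemma boxP_or_kdecomp (f : 'I_d.+1 -> 'rV[int]_N) p :
  empty_simplex R V f -> in_box_simplex R f p -> in_boxP R V p \/ kdecomp 1 p.
Proof.
move=> ef bp; case: (pselect (kdecomp 1 p)) => h; [by right|left].
split; first by exists f.
case=> m [pm] /decompP; rewrite -pm -surjective_pairing; exact: h.
Qed.

Lemma boxP_not_kdecomp p : in_boxP R V p -> ~ kdecomp 1 p.
Proof.
move=> [[f [ef bp]] nd] dp; apply: nd; have p0 := cone_deg_ge0 (box_cone ef bp).
exists `|p.2|%N; split; first by lia.
apply/decompP; have -> : (`|p.2|%N)%:Z = p.2 by lia.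
by rewrite -surjective_pairing.
Qed.

(* A box point of degree [d] would reflect, via [r -> 1 - r], to a lattice point
   in the interior of the empty simplex. *)
Lemma box_deg (f : 'I_d.+1 -> 'rV[int]_N) p : (0 < d)%N ->
  empty_simplex R V f -> in_box_simplex R f p -> p.2 < d%:Z.
Proof.
move=> d0 ef [r [r01 h]]; have [Cf [rk emp]] := ef.
have [fI _] := simplex_basis V0 (fun i => empty_simplex_cone i ef) rk.
have ep : cmb (fun i => hom R (pt (f i))) r = hom R p by apply/cmb_homP.
have lt : p.2 < d%:Z + 1.
  rewrite -(ltr_int R) h.2 intrD -pmulrn natr1.
  by apply: sum_lt_card => i; case/andP: (r01 i).
case: (eqVneq p.2 d%:Z) => [pd|]; last by lia.
pose y : lpt N := \sum_i pt (f i) - p.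
have ey : cmb (fun i => hom R (pt (f i))) (fun i => 1 + (-1) * r i) = hom R y.
  rewrite cmb_lin ep scaleN1r /y homD homN hom_sum; congr (_ - _).
  by apply: eq_bigr => i _; rewrite scale1r.
have y2 : y = pt y.1.
  rewrite [LHS]surjective_pairing; congr pair; rewrite /y /=.
  have -> : \sum_i pt (f i) = \sum_i pt (f i) *+ 1.
    by apply: eq_bigr => i _; rewrite mulr1n.
  by rewrite sum_pt /= sum1_card card_ord pd; lia.
have [k yk] : exists k, y.1 = f k.
  apply: emp; apply/in_poly_family; exists (fun i => 1 + (-1) * r i).
    by move=> i; have := r01 i; lra.
  by rewrite ey -y2.
have z : cmb (fun i => hom R (pt (f i)))
    (fun i => 1 + (-1) * r i + (-1) * (i == k)%:R) = 0.
  rewrite (cmb_lin _ (fun i => 1 + (-1) * r i)).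
  rewrite ey y2 yk (cmb_delta (fun i => hom R (pt (f i)))).
  by rewrite scaleN1r subrr.
(* Since [d] is positive there is a second vertex [j]; the reflected point has coordinate [1 - r j]
   there, which is positive, whereas the vertex [f k] has 0. *)
have [j jk] : exists j : 'I_d.+1, j != k.
  case: (eqVneq k ord0) => [->|]; last by exists ord0; rewrite eq_sym.
  have d1 : (1 < d.+1)%N by [].
  by exists (Ordinal d1).
have := fI _ z j; rewrite (negbTE jk) mulr0 addr0; have := r01 j.
by move=> h1 h2; exfalso; lra.
Qed.

Lemma mu_hole_exists : (0 < d)%N -> exists m : nat,
  [/\ mu_hole R V m, (0 < m)%N, forall x, in_boxP R V x -> x.2 <= m%:Z,
      (2 <= d)%N -> (m <= d.-1)%N
    & m = 1%N \/ exists2 x, in_boxP R V x & x.2 = m%:Z].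
Proof.
move=> d0; case: (pselect (exists x, in_boxP R V x)) => [[x0 bx0]|no]; last first.
  have no' x : ~ in_boxP R V x by move=> bx; apply: no; exists x.
  (* The conventional value 1 is at most [d - 1] only once [d] is at least 2. *)
  exists 1%N; split=> //; [by left|by move=> x /no'|by case: (d) => [|[]]|by left].
have bd x : in_boxP R V x -> 0 < x.2 < d%:Z.
  move=> bx; have [[f [ef bp]] _] := bx; rewrite (box_deg d0 ef bp) andbT.
  have Cx := box_cone ef bp; have := cone_deg_ge0 Cx.
  rewrite le_eqVlt => /orP[/eqP xz|//]; case: (boxP_not_kdecomp bx).
  by rewrite (cone_deg0 Cx) //; exact: kdecomp0.
pose P n := `[< exists2 x, in_boxP R V x & x.2 = n%:Z >].
have exP : exists n, P n.
  exists `|x0.2|%N; apply/asboolP; exists x0 => //; have := bd _ bx0; lia.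
have Pd n : P n -> (n <= d)%N.
  by move=> /asboolP[x bx xn]; have := bd _ bx; rewrite xn; lia.
case: (ex_maxnP exP Pd) => m /asboolP[x bx xm] mmax.
have top y : in_boxP R V y -> y.2 <= m%:Z.
  move=> by_; have yd := bd _ by_; have : P `|y.2|%N.
    by apply/asboolP; exists y => //; lia.
  by move/mmax; lia.
have := bd _ bx; rewrite xm => md.
exists m; split=> //; [|by lia|by lia|by right; exists x].
by right; split=> //; exists x.
Qed.

Lemma dil_dil m k W : dil m (dil k W) = dil (m * k) W :> seq 'rV[int]_N.
Proof.
by rewrite /dil -map_comp; apply: eq_map => v /=; rewrite -mulrnA mulnC.
Qed.

Lemma IDP_dil k : (0 < k)%N -> (forall x, in_boxP R V x -> x.2 <= k%:Z) ->
  IDP R (dil k V).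
Proof.
move=> k0 hole [//|n] _ a; rewrite dil_dil => /(in_poly_dil _ _ _ V0) Cx.
apply/decomp_dilP => //.
have [f [p [z [ef bp xE]]]] := box_decomposition V0 Cx.
have Cf i : C (pt (f i)) by exact: empty_simplex_cone.
have dz := kdecomp_vertices z Cf.
case: (boxP_or_kdecomp ef bp) => [bP|dp]; last first.
  by apply: (@kdecomp_group k n.+1) => //; rewrite xE; exact: kdecompD.
have pk := hole _ bP; have Cp := box_cone ef bp; have p0 := cone_deg_ge0 Cp.
have [e pe] : exists e : nat, p.2 = e%:Z by exists `|p.2|%N; lia.
rewrite xE; case: dz => s [sC sE]; rewrite sE sum_pair muln1.
have sz : (size s = n.+1 * k - e)%N.
  by have := congr1 snd xE; rewrite sE sum_pair muln1 /= pe; lia.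
have ek : (e <= k)%N by lia.
have ts : size (take (k - e) s) = (k - e)%N.
  by rewrite size_take_min; apply/minn_idPl; rewrite sz mulSn; lia.
(* The first [k - e] height-one points raise [p] to height [k]; exactly [n * k] remain to be
   grouped. *)
have -> : p + (\sum_(b <- s) b, (size s)%:Z) =
    (p + (\sum_(b <- take (k - e) s) b, (size (take (k - e) s))%:Z)) +
    (\sum_(b <- drop (k - e) s) b, (size (drop (k - e) s))%:Z).
  by rewrite -addrA -{1 2}(cat_take_drop (k - e) s) big_cat size_cat PoszD.
apply: kdecompD; last first.
  apply: (@kdecomp_group _ n); last by rewrite /= size_drop sz mulSn; lia.
  exists (drop (k - e) s); rewrite sum_pair muln1; split=> // b /mem_drop.
  exact: sC.
set y := _ + _; have y2 : y = (y.1, k%:Z).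
  rewrite [LHS]surjective_pairing; congr pair; rewrite /y /= pe ts; lia.
rewrite y2; apply: kdecomp1; rewrite -y2; apply: coneD => //.
by apply: cone_seq => b /mem_take; exact: sC.
Qed.

(** * Irreducible elements, very ampleness and the Hilbert basis *)

Definition irr x := [/\ C x, x != 0
  & forall y z, C y -> C z -> x = y + z -> y = 0 \/ z = 0].

Lemma cone_deg_gt0 x : C x -> x != 0 -> 0 < x.2.
Proof.
move=> Cx x0; rewrite lt_def (cone_deg_ge0 Cx) andbT.
by apply: contra x0 => /eqP/(cone_deg0 Cx)->.
Qed.

Lemma irr_pt a : C (pt a) -> irr (pt a).
Proof.
move=> Ca; split=> //; first by apply/eqP => /(congr1 snd).
move=> y z Cy Cz e; case: (eqVneq y 0) => [->|y0]; [by left|right].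
have := cone_deg_gt0 Cy y0; have := cone_deg_ge0 Cz.
have /= e2 := congr1 snd e => z0 y1; apply: (cone_deg0 Cz).
have : y.2 + z.2 = 1 by rewrite e2.
by lia.
Qed.

(** In the splitting into box part and vertex part one summand vanishes, so an irreducible element
    is a box point or a single height-one point. *)
Lemma irr_deg m x : (0 < m)%N -> (forall x, in_boxP R V x -> x.2 <= m%:Z) ->
  irr x -> x.2 <= m%:Z.
Proof.
move=> m0 hole [Cx x0 xi].
have dec_deg : kdecomp 1 x -> x.2 <= m%:Z.
  case=> -[|b s] [sC xE]; first by rewrite xE big_nil eqxx in x0.
  have Cb := sC b (mem_head _ _).
  have Cr : C (\sum_(c <- s) pt c).
    rewrite big_seq_cond; apply: cone_sum => c; rewrite andbT => cs.
    by apply: sC; rewrite inE cs orbT.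
  rewrite big_cons in xE.
  case: (xi _ _ Cb Cr xE) => [/(congr1 snd)//|r0].
  by rewrite xE /= [\sum_(c <- s) _]r0 /= addr0; lia.
have [f [p [z [ef bp xE]]]] := box_decomposition V0 Cx.
have Cf i : C (pt (f i)) by exact: empty_simplex_cone.
have dz := kdecomp_vertices z Cf.
case: (xi _ _ (box_cone ef bp) (kdecomp_cone dz) xE) => z0.
  by apply: dec_deg; rewrite xE z0 add0r.
rewrite z0 addr0 in xE; rewrite -xE in bp.
by case: (boxP_or_kdecomp ef bp) => [/hole|/dec_deg].
Qed.

Lemma irr_generate x : C x -> exists s : seq (lpt N),
  (forall y, y \in s -> irr y) /\ x = \sum_(y <- s) y.
Proof.
move: {2}(absz x.2).+1 (ltnSn (absz x.2)) => n; elim: n x => // n IH x lt Cx.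
case: (eqVneq x 0) => [->|x0]; first by exists [::]; rewrite big_nil.
case: (pselect (irr x)) => [ix|nix].
  by exists [:: x]; rewrite big_seq1; split=> // y; rewrite inE => /eqP->.
have [y [z [[Cy Cz] xE [y0 z0]]]] : exists y z,
    [/\ C y /\ C z, x = y + z & y != 0 /\ z != 0].
  apply: contrapT => no; apply: nix; split=> // y z Cy Cz xE.
  case: (eqVneq y 0) => [->|y0]; [by left|right].
  by apply/eqP; apply: contrapT => /negP z0; apply: no; exists y, z.
have yd := cone_deg_gt0 Cy y0; have zd := cone_deg_gt0 Cz z0.
have /= x2 := congr1 snd xE; rewrite /= in x2.
have e2 : x.2 = y.2 + z.2 by [].
have [||s [si sE]] := IH y; [by lia|by []|].
have [||t [ti tE]] := IH z; [by lia|by []|].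
exists (s ++ t); rewrite big_cat xE sE tE; split=> // u.
by rewrite mem_cat => /orP[/si|/ti].
Qed.

Lemma very_ample_dil k : (0 < k)%N -> (forall x, irr x -> x.2 <= k%:Z) ->
  very_ample R (dil k V).
Proof.
(* The term [d.+1 * d] lets the pigeonhole principle give one of the [d + 1] vertices multiplicity
   at least [d * k]; the extra [d] absorbs the degree of the box point. *)
move=> k0 hk; exists (d.+1 * d + d)%N => n n0 _ a.
rewrite dil_dil => /(in_poly_dil _ _ _ V0) Cx; apply/decomp_dilP => //.
have [f [p [z [ef bp xE]]]] := box_decomposition V0 Cx.
have Cf i : C (pt (f i)) by exact: empty_simplex_cone.
have Cp := box_cone ef bp; have p0 := cone_deg_ge0 Cp.
have [e pe] : exists e : nat, p.2 = e%:Z by exists `|p.2|%N; lia.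
have ed : (e <= d)%N.
  have [r [r01 [_ er]]] := bp.
  rewrite -ltnS -(ltr_nat R) pmulrn -pe er.
  by apply: sum_lt_card => i; case/andP: (r01 i).
have sz : (\sum_i z i = n * k - e)%N.
  by have := congr1 snd xE; rewrite sum_pt /= pe; lia.
have [i zi] : exists i, (d * k <= z i)%N.
  apply: contrapT => /forallNP no.
  have : (\sum_i z i <= \sum_(i < d.+1) (d * k).-1)%N.
    by apply: leq_sum => i _; have := no i; lia.
  have := no ord0.
  rewrite sz sum_nat_const card_ord; move: (n0) => h.
  have : ((d.+1 * d + d) * k <= n * k)%N by rewrite leq_mul2r n0 orbT.
  by move: ed; nia.
have [s [si sE]] := irr_generate Cp.
(* The number of copies of [f i] needed to raise every irreducible part of [p] to height [k]. There
   are at most [d] parts, each needing at most [k] copies. *)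
pose M := (\sum_(h <- s) (k - absz h.2))%N.
pose P0 : lpt N := \sum_(h <- s) (h + pt (f i) *+ (k - absz h.2)).
have P0E : P0 = p + pt (f i) *+ M.
  by rewrite /P0 big_split /= -sE /M -sumrMnr.
have hpos h : h \in s -> 0 < h.2 <= k%:Z.
  by move=> hs; have ih := si h hs; rewrite hk // andbT; case: ih => Ch h0 _; exact: cone_deg_gt0.
have Md : (M <= d * k)%N.
  apply: (@leq_trans (size s * k)).
    rewrite /M -sum1_size big_distrl /=; apply: leq_sum => h _.
    by rewrite mul1n leq_subr.
  rewrite leq_mul2r; apply/orP; right; apply: leq_trans ed.
  rewrite -lez_nat -pe sE; clear -hpos; elim: s hpos => [|h s IH] hpos.
    by rewrite big_nil.
  rewrite big_cons /=; have /IH : forall h, h \in s -> 0 < h.2 <= k%:Z.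
    by move=> h' h's; apply: hpos; rewrite inE h's orbT.
  have := hpos h (mem_head _ _).
  change ((h + \sum_(j <- s) j).2) with (h.2 + (\sum_(j <- s) j).2).
  by rewrite gtz0_ge1 => /andP[h1 _] h2; rewrite -add1n PoszD; apply: lerD h1 h2.
have P0d : kdecomp k P0.
  rewrite /P0 big_seq_cond; elim/big_ind: _ => [||h]; [exact: kdecomp0|exact: kdecompD|].
  rewrite andbT => hs; set y := _ + _.
  have y2 : y = (y.1, k%:Z).
    rewrite [LHS]surjective_pairing; congr pair.
    have := hpos h hs.
    have -> : y.2 = h.2 + (k - absz h.2)%N%:Z.
      rewrite /y; change (h.2 + (pt (f i) *+ (k - absz h.2)).2 = h.2 + (k - absz h.2)%N%:Z).
      by congr (_ + _); elim: (k - _)%N => // m IH; rewrite mulrS /= [X in 1 + X]IH; lia.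
    lia.
  rewrite y2; apply: kdecomp1; rewrite -y2; apply: coneD; last exact: coneMn.
  by case: (si h hs).
have xE' : (a, (n * k)%N%:Z) =
    P0 + \sum_j pt (f j) *+ (if j == i then z j - M else z j)%N.
  rewrite xE P0E -addrA; congr (_ + _).
  rewrite (bigD1 i) //= [in RHS](bigD1 i) //= eqxx addrA -mulrnDr subnKC; last first.
    exact: leq_trans Md zi.
  by congr (_ + _); apply: eq_bigr => j /negbTE->.
rewrite xE'; apply: kdecompD => //.
set z' := fun j => (if j == i then z j - M else z j)%N.
have dz := kdecomp_vertices z' Cf.
pose S : int := (\sum_j pt (f j) *+ z' j).2.
have S0 : 0 <= S := cone_deg_ge0 (kdecomp_cone dz).
case: P0d => t [tC tE].
have e2 : (n * k)%N%:Z = (size t * k)%N%:Z + S.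
  by have := congr1 snd xE'; rewrite tE sum_pair.
apply: (@kdecomp_group k (n - size t)) => //; change (S = ((n - size t) * k)%N%:Z).
by clearbody S; rewrite mulnBl; lia.
Qed.

Lemma zcomb_sum (H : seq (lpt N)) x : zcomb H x <->
  exists c : 'I_(size H) -> nat, x = \sum_(i < size H) H`_i *+ c i.
Proof.
have fstE (c : 'I_(size H) -> nat) :
    (\sum_(i < size H) H`_i *+ c i).1 = \sum_(i < size H) (nth (0, 0) H i).1 *+ c i.
  rewrite (raddf_sum fst); apply: eq_bigr => i _; exact: (raddfMn fst).
have sndE (c : 'I_(size H) -> nat) :
    (\sum_(i < size H) H`_i *+ c i).2 = \sum_(i < size H) (nth (0, 0) H i).2 *+ c i.
  rewrite (raddf_sum snd); apply: eq_bigr => i _; exact: (raddfMn snd).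
split=> [[c [e1 e2]]|[c ->]]; exists c; last by rewrite fstE sndE.
by rewrite [x]surjective_pairing [RHS]surjective_pairing fstE sndE e1 e2.
Qed.

Lemma zcomb_mem (H s : seq (lpt N)) : {subset s <= H} -> zcomb H (\sum_(y <- s) y).
Proof.
elim: s => [|y s IH] sH.
  by apply/zcomb_sum; exists (fun=> 0%N); rewrite big_nil big1.
rewrite big_cons; have /IH/zcomb_sum[c ->] : {subset s <= H}.
  by move=> u us; apply: sH; rewrite inE us orbT.
have /(nthP 0)[j jH yE] := sH y (mem_head _ _).
apply/zcomb_sum; exists (fun i => ((i == Ordinal jH) + c i)%N).
under [RHS]eq_bigr do rewrite mulrnDr.
rewrite big_split /=; congr (_ + _).
rewrite (bigD1 (Ordinal jH)) //= eqxx mulr1n yE big1 ?addr0 // => i /negbTE->.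
by rewrite mulr0n.
Qed.

(** Split one copy of a generator with nonzero contribution off an expression of [x]; irreducibility
    makes the rest zero. *)
Lemma irr_hilbert (H : seq (lpt N)) x : hilbert_basis R V H -> irr x -> x \in H.
Proof.
move=> hH [Cx x0 xi]; have CH h : h \in H -> C h.
  move=> hh; apply/hH; have := @zcomb_mem H [:: h]; rewrite big_seq1; apply.
  by move=> u; rewrite inE => /eqP->.
have /hH/zcomb_sum[c xE] := Cx.
have [i ni] : exists i : 'I_(size H), H`_i *+ c i != 0.
  apply: contrapT => /forallNP no; case/negP: x0; apply/eqP.
  by rewrite xE big1 // => i _; apply/eqP; apply: contrapT => /negP; exact: no.
case ci: (c i) ni => [|k]; first by rewrite mulr0n eqxx.
have Hi : H`_i \in H by exact: mem_nth.
move=> ni; have Hi0 : H`_i != 0.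
  by apply: contra ni => /eqP->; rewrite mul0rn.
have xE' : x = H`_i + (H`_i *+ k + \sum_(j < size H | j != i) H`_j *+ c j).
  by rewrite xE (bigD1 i) //= ci mulrS addrA.
have Cr : C (H`_i *+ k + \sum_(j < size H | j != i) H`_j *+ c j).
  apply: coneD; first by apply: coneMn; exact: CH.
  by apply: cone_sum => j _; apply: coneMn; apply: CH; exact: mem_nth.
case: (xi _ _ (CH _ Hi) Cr xE') => e; first by rewrite e eqxx in Hi0.
by rewrite xE' e addr0.
Qed.

Lemma mu_hilb_exists m : (0 < m)%N ->
  (forall x, in_boxP R V x -> x.2 <= m%:Z) -> exists h : nat,
  [/\ mu_hilb R V h, (0 < h)%N, (h <= m)%N & forall x, irr x -> x.2 <= h%:Z].
Proof.
move=> m0 hole.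
have irrb x : irr x -> 0 < x.2 <= m%:Z.
  by move=> ix; rewrite (irr_deg m0 hole ix) andbT; case: ix => Cx x0 _; exact: cone_deg_gt0.
have /choice[pts pP] : forall n : nat, exists s : seq 'rV[int]_N,
    uniq s /\ forall a, a \in s <-> C (a, n%:Z).
  by move=> n; exact: cone_finite.
(* The irreducibles form a finite list because their degrees are at most [m]. *)
pose L := [seq x <- flatten [seq [seq ((a, n%:Z) : lpt N) | a <- pts n] | n <- iota 0 m.+1]
   | `[< irr x >]].
have LP x : x \in L <-> irr x.
  rewrite mem_filter; split=> [/andP[/asboolP]//|ix].
  apply/andP; split; first exact/asboolP.
  have xb := irrb x ix; have [Cx _ _] := ix.
  have xE : x = (x.1, (absz x.2)%:Z).
    by rewrite {1}[x]surjective_pairing; congr pair; lia.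
  apply/flattenP; exists [seq (a, (absz x.2)%:Z) | a <- pts (absz x.2)].
    by apply/mapP; exists (absz x.2) => //; rewrite mem_iota; lia.
  apply/mapP; exists x.1 => //; case: (pP (absz x.2)) => _ h; apply/h.
  by rewrite -xE.
have hL : hilbert_basis R V L.
  move=> x; split=> [/zcomb_sum[c ->]|/irr_generate[s [si ->]]].
    apply: cone_sum => i _; apply: coneMn.
    by have /LP[] : L`_i \in L by exact: mem_nth.
  by apply: zcomb_mem => y /si/LP.
pose P n := `[< exists2 x, irr x & x.2 = n%:Z >].
have exP : exists n, P n.
  exists 1%N; apply/asboolP; exists (pt V`_0) => //; apply: irr_pt.
  by apply: cone_mem; apply: mem_nth; rewrite lt0n size_eq0.
have Pm n : P n -> (n <= m)%N.
  by move=> /asboolP[x ix xn]; have := irrb _ ix; rewrite xn; lia.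
case: (ex_maxnP exP Pm) => h /asboolP[x ix xh] hmax.
have top y : irr y -> y.2 <= h%:Z.
  move=> iy; have yd := irrb _ iy; have : P (absz y.2).
    by apply/asboolP; exists y => //; lia.
  by move/hmax; lia.
have := irrb _ ix; rewrite xh => hm.
exists h; split=> //; [|by lia|by lia].
split.
  exists L; split=> // H' _ nsub hH'; apply: nsub => y /LP; exact: irr_hilbert.
(* A reducible member of a minimal [H] would make [L] a strictly smaller Hilbert basis inside
   [H]. *)
move=> H [hH Hmin]; have HL y : y \in H -> irr y.
  move=> yH; apply: contrapT => ny; apply: (Hmin L) => //.
    by move=> u /LP; exact: irr_hilbert.
  by move=> sub; apply: ny; apply/LP; exact: sub.
by split=> [|y /HL/top//]; exists x => //; exact: irr_hilbert.
Qed.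

Lemma mu_ehr_exists : (0 < d)%N -> exists m : nat,
  [/\ mu_ehr R V m, (0 < m)%N, (m <= d)%N
    & forall x (n : nat), in_boxP R V x -> x.2 = n%:Z -> (0 < n)%N -> (n <= m)%N].
Proof.
move=> d0; have [f [ef _]] := empty_simplex_cover V0 (cone0 R V).
have Cf i := empty_simplex_cone i ef.
have [dl isd _] := delta_of_simplex V0 Cf ef.2.1.
have dn x (n : nat) : in_boxP R V x -> x.2 = n%:Z -> dl n != 0.
  move=> [[g [eg bx]] _] xn.
  (* Each box point is tested on a triangulation adapted to its own simplex, and uniqueness carries
     the result back to [dl]. *)
  have [dl' isd' nz] := delta_of_simplex V0 (fun i => empty_simplex_cone i eg) eg.2.1.
  by rewrite (is_delta_uniq isd isd') (nz x).
have bd n : dl n != 0 -> (n <= d)%N.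
  by move=> nz; rewrite leqNgt; apply: contra nz => /isd.1 ->.
case: (pselect (exists n, (0 < n)%N && (dl n != 0))) => [exn|no]; last first.
  have z i : (0 < i)%N -> dl i = 0.
    by move=> i0; apply/eqP; apply: contrapT => /negP nz; apply: no; exists i; rewrite i0.
  exists 1%N; split=> //.
    split=> [|dl' isd']; first by exists dl.
    by left; split=> // i i0; rewrite (is_delta_uniq isd' isd) z.
  by move=> x n bx xn n0; have := dn x n bx xn; rewrite z // eqxx.
have bd' n : (0 < n)%N && (dl n != 0) -> (n <= d)%N by case/andP=> _ /bd.
case: (ex_maxnP exn bd') => m /andP[m0 nz] mmax.
exists m; split=> //; [|exact: bd|]; last first.
  by move=> x n bx xn n0; apply: mmax; rewrite n0 (dn x).
split=> [|dl' isd']; first by exists dl.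
have E := is_delta_uniq isd' isd.
right; split; rewrite ?E // => i mi; rewrite E; apply/eqP; apply: contrapT.
move=> /negP nzi; have := mmax i; rewrite nzi (leq_trans _ mi) // => /(_ isT).
by rewrite leqNgt mi.
Qed.

End Invariants.

(** * Comparison of the invariants *)

Lemma ex_is_least (p : nat -> Prop) k : p k -> exists m, is_least p m.
Proof.
move=> pk; have ex : exists n, `[< p n >] by exists k; apply/asboolP.
case: (ex_minnP ex) => m /asboolP pm mmin; exists m; split=> // n pn.
by apply: mmin; apply/asboolP.
Qed.

Theorem theorem1p1 (R : realType) (N : nat) (V : seq 'rV[int]_N) (d : nat) :
  V != [::] -> dimP R V = d -> (0 < d)%N ->
  exists mva mmidp midp mhilb mhole mehr : nat,
    is_least (fun k => (0 < k)%N /\ very_ample R (dil k V)) mva /\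
        is_least (fun k => (0 < k)%N /\ IDP R (dil k V)) mmidp /\
        is_least (fun k => (0 < k)%N /\
                   forall n : nat, (k <= n)%N -> IDP R (dil n V)) midp /\
        mu_hilb R V mhilb /\
        mu_hole R V mhole /\
        mu_ehr R V mehr /\
     ((1 <= mva)%N /\ (mva <= mmidp)%N /\ (mmidp <= midp)%N /\
      (midp <= mhole)%N /\ (mhole <= mehr)%N /\ (mehr <= d)%N) /\
     ((1 <= mva)%N /\ (mva <= mhilb)%N /\ (mhilb <= mhole)%N /\
      ((2 <= d)%N -> (mhole <= d.-1)%N)).
Proof.
move=> V0 <- d0.
have [mhole [holeP hole0 top holed holex]] := mu_hole_exists V0 d0.
have [mhilb [hilbP hilb0 hilble hilbtop]] := mu_hilb_exists V0 hole0 top.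
have [mehr [ehrP ehr0 ehrd ehrx]] := mu_ehr_exists V0 d0.
have idp n : (mhole <= n)%N -> IDP R (dil n V).
  move=> le; apply: IDP_dil => //; first exact: leq_trans le.
  by move=> x /top; move=> h; apply: le_trans h _; rewrite lez_nat.
have idp_va k : IDP R (dil k V) -> very_ample R (dil k V).
  by move=> h; exists 0%N => n _; exact: h.
(* The value [mhole] satisfies all three predicates, so the least values exist; the inequalities
   then come from testing each minimum on a larger invariant. *)
have [midp midpP] := @ex_is_least (fun k => (0 < k)%N /\
  forall n : nat, (k <= n)%N -> IDP R (dil n V)) mhole (conj hole0 idp).
have [mmidp mmidpP] := @ex_is_least (fun k => (0 < k)%N /\ IDP R (dil k V))
  mhole (conj hole0 (idp _ (leqnn _))).
have [mva mvaP] := @ex_is_least (fun k => (0 < k)%N /\ very_ample R (dil k V))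
  mhole (conj hole0 (idp_va _ (idp _ (leqnn _)))).
exists mva, mmidp, midp, mhilb, mhole, mehr; do 7!split=> //.
  split; first by case: mvaP => -[].
  split; first by apply: mvaP.2; case: mmidpP => -[h1 h2] _; split=> //; exact: idp_va.
  split; first by apply: mmidpP.2; case: midpP => -[h1 h2] _; split=> //; exact: h2.
  split; first exact: midpP.2.
  split=> //; case: holex => [->//|[x bx xm]].
  exact: ehrx bx xm hole0.
split; first by case: mvaP => -[].
split=> //; apply: mvaP.2; split=> //; exact: very_ample_dil.
Qed.
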